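(* Let $\{(R_n,B_n)\}_{n=1}^\infty\subseteq\mathcal{D}_d$ be a sequence of admissible pairs in $\mathbb{R}^d$. Suppose there is an admissible pair $(R,B)$ occurring infinitely many times in the sequence such that all diagonal entries of $R$ are $\ge d+1$. Then the infinite convolution $$\mu=\delta_{R_1^{-1}B_1}*\delta_{(R_2R_1)^{-1}B_2}*\cdots*\delta_{(R_n\cdots R_1)^{-1}B_n}*\cdots$$ is a spectral measure with a spectrum contained in $\mathbb{Z}^d$.
   Context: $\mathcal{D}_d$ is the set of pairs $(R,B)$ with $R=\mathrm{diag}(m_1,\dots,m_d)$, $m_1,\dots,m_d\ge2$ integers, and $B$ a nonempty subset of $\{0,\dots,m_1-1\}\times\cdots\times\{0,\dots,m_d-1\}$. For a finite $A\subseteq\mathbb{R}^d$, $\delta_A=\frac{1}{\#A}\sum_{a\in A}\delta_a$; for a sequence in $\mathcal{D}_d$ the finite convolutions $\delta_{R_1^{-1}B_1}*\cdots*\delta_{(R_n\cdots R_1)^{-1}B_n}$ converge weakly, and $\mu$ denotes the limit. A pair $(R,B)$ ($R$ expanding integer matrix, $B\subseteq\mathbb{Z}^d$ finite) is admissible if there is a finite $L\subseteq\mathbb{Z}^d$ with $\#L=\#B$ such that $\big[\frac{1}{\sqrt{\#B}}e^{-2\pi i(R^{-1}b)\cdot\ell}\big]_{b\in B,\ell\in L}$ is unitary. A Borel probability measure $\mu$ is spectral if there is a countable $\Lambda\subseteq\mathbb{R}^d$ (a spectrum) with $\{e^{2\pi i\lambda\cdot x}\}_{\lambda\in\Lambda}$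 an orthonormal basis of $L^2(\mu)$. *)

(* Defs.v *)
From HB Require Import structures.
From mathcomp Require Import all_boot all_order all_algebra.
From mathcomp Require Import complex.
From mathcomp Require Import all_classical all_reals all_analysis.
Set Implicit Arguments. Unset Strict Implicit. Unset Printing Implicit Defensive.
Import Order.TTheory GRing.Theory Num.Theory.
Import numFieldNormedType.Exports.
Local Open Scope classical_set_scope.
Local Open Scope ring_scope.


Definition Rd (R : realType) (d : nat) := g_sigma_algebraType (@open 'rV[R]_d).

Definition expi (R : realType) (t : R) : R[i] := ((cos t) +i* (sin t))%C.

Definition dotv (R : realType) (d : nat) (x y : 'rV[R]_d) : R :=
  \sum_(i < d) x 0 i * y 0 i.

(* A pair (R,B) of D_d: R = diag(m_1,...,m_d), B a finite set of integer
   vectors, represented by a duplicate-free sequence. *)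
Definition in_Dd (d : nat) (m : 'I_d -> nat) (B : seq 'rV[int]_d) : Prop :=
  (forall i, (2 <= m i)%N) /\ uniq B /\ (0 < size B)%N /\
  (forall b, b \in B -> forall i, (0 <= b 0 i) /\ (b 0 i < (m i)%:Z)).

Definition Rinv_dot (R : realType) (d : nat) (m : 'I_d -> nat)
    (b l : 'rV[int]_d) : R :=
  \sum_(i < d) ((b 0 i)%:~R / (m i)%:R) * (l 0 i)%:~R.

Definition adm_matrix (R : realType) (d : nat) (m : 'I_d -> nat)
    (B L : seq 'rV[int]_d) : 'M[R[i]]_(size B) :=
  \matrix_(j, k)
    (((Num.sqrt (size B)%:R)^-1)%:C%C *
      expi (- (2 * pi * Rinv_dot R m (nth 0 B j) (nth 0 L k)))).

Definition unitary_mx (R : realType) (n : nat) (U : 'M[R[i]]_n) : Prop :=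
  (map_mx conjc U)^T *m U = 1%:M /\ U *m (map_mx conjc U)^T = 1%:M.

Definition admissible (R : realType) (d : nat) (m : 'I_d -> nat)
    (B : seq 'rV[int]_d) : Prop :=
  exists L : seq 'rV[int]_d, uniq L /\ size L = size B /\
    unitary_mx (adm_matrix R m B L).

(* The sequence {(R_n,B_n)}_{n>=1} is given by m : nat -> 'I_d -> nat and
   Bs : nat -> seq, where index k : nat stands for n = k+1. *)

(* (R_{k+1} ... R_1)^{-1} b  (diagonal matrices) *)
Definition scaled_digit (R : realType) (d : nat) (m : nat -> 'I_d -> nat)
    (k : nat) (b : 'rV[int]_d) : 'rV[R]_d :=
  \row_(i < d) ((b 0 i)%:~R / (\prod_(j < k.+1) m j i)%:R).

(* The support points, with multiplicity, of
   delta_{R_1^{-1}B_1} * ... * delta_{(R_n...R_1)^{-1}B_n}: *)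
Fixpoint conv_points (R : realType) (d : nat) (m : nat -> 'I_d -> nat)
    (Bs : nat -> seq 'rV[int]_d) (n : nat) : seq 'rV[R]_d :=
  match n with
  | O => [:: 0]
  | n'.+1 => [seq x + scaled_digit R m n' b
               | x <- conv_points R m Bs n', b <- Bs n']
  end.

(* integral of f against the n-th finite convolution
   delta_{R_1^{-1}B_1} * ... * delta_{(R_n...R_1)^{-1}B_n}
   (each delta_A being the uniform probability on A) *)
Definition conv_integral (R : realType) (d : nat) (m : nat -> 'I_d -> nat)
    (Bs : nat -> seq 'rV[int]_d) (n : nat) (f : 'rV[R]_d -> R) : R :=
  (size (conv_points R m Bs n))%:R^-1 *
    \sum_(x <- conv_points R m Bs n) f x.

Definition weak_limit (R : realType) (d : nat) (m : nat -> 'I_d -> nat)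
    (Bs : nat -> seq 'rV[int]_d) (mu : probability (Rd R d) R) : Prop :=
  forall f : 'rV[R]_d -> R, continuous f -> (exists M : R, forall x, `|f x| <= M) ->
    (fun n => conv_integral m Bs n f) @ \oo --> Rintegral mu setT (f : Rd R d -> R).

Definition cintegral (R : realType) (d : nat) (mu : probability (Rd R d) R)
    (g : Rd R d -> R[i]) : R[i] :=
  ((Rintegral mu setT (fun x => complex.Re (g x))) +i* (Rintegral mu setT (fun x => complex.Im (g x))))%C.

Definition L2 (R : realType) (d : nat) (mu : probability (Rd R d) R)
    (g : Rd R d -> R[i]) : Prop :=
  measurable_fun setT (fun x => complex.Re (g x)) /\
  measurable_fun setT (fun x => complex.Im (g x)) /\
  mu.-integrable setT (fun x => ((complex.Re (g x)) ^+ 2 + (complex.Im (g x)) ^+ 2)%:E).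

Definition inner (R : realType) (d : nat) (mu : probability (Rd R d) R)
    (f g : Rd R d -> R[i]) : R[i] :=
  cintegral mu (fun x => f x * conjc (g x)).

Definition expo (R : realType) (d : nat) (lam : 'rV[R]_d) : Rd R d -> R[i] :=
  fun x => expi (2 * pi * dotv lam x).

Definition is_spectrum (R : realType) (d : nat) (mu : probability (Rd R d) R)
    (Lam : set 'rV[R]_d) : Prop :=
  countable Lam /\
  (forall lam, Lam lam -> L2 mu (expo lam)) /\
  (forall lam lam', Lam lam -> Lam lam' ->
     inner mu (expo lam) (expo lam') = (lam == lam')%:R) /\
  (forall f, L2 mu f -> (forall lam, Lam lam -> inner mu f (expo lam) = 0) ->
     {ae mu, forall x, f x = 0}).

Definition spectral (R : realType) (d : nat) (mu : probability (Rd R d) R) : Prop :=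
  exists Lam : set 'rV[R]_d, is_spectrum mu Lam.

Definition Zd (R : realType) (d : nat) : set 'rV[R]_d :=
  [set v | forall i, v 0 i \is a Num.int].

(* Main.v *)
Require Import Defs.
From HB Require Import structures.
From mathcomp Require Import all_boot all_order all_algebra.
From mathcomp Require Import complex.
From mathcomp Require Import all_classical all_reals all_analysis.
From mathcomp Require Import measurable_realfun.
From mathcomp Require Import ring lra zify.
Import Order.TTheory GRing.Theory Num.Theory.
Import numFieldNormedType.Exports.
Local Open Scope classical_set_scope.
Local Open Scope ring_scope.


(** Write [X_n] for the atoms of the [n]-th finite convolution, [P_n] for the
    product of the first [n] matrices and [T_{n,k}] for the atoms of the tail
    made of the levels [n, ..., n + k - 1].

    Admissibility gives, at each level, finite sets [S] of integer vectors for
    which Parseval holds on [X_n]; this survives the passage to the next level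
    and arbitrary translations of the elements of [S] by [P_n Z^d].  These
    translations are used to keep the Fourier transform of the tail away from
    zero on [S].  That this is possible is the equipositivity lemma: if all
    [m_i >= d + 1] and the tail starts with [(diag m, B)], some integer
    translate of any frequency has tail transform at least [eps].  Otherwise,
    testing against a nonnegative trigonometric kernel concentrated near a point
    [q = b0 + t0], mass near [q] would have to be cancelled by mass near some
    [q + m z], [z <> 0]; choosing [b0] to minimise [sum_i sgn_i b_i / m_i], with
    signs read off [t0], this is impossible because [d / (d + 1) < 1].

    The union [Lambda] of the nested sets [S_j] is orthonormal in [L^2(mu)] by
    weak convergence.  For a bounded Lipschitz [g], comparing Parseval at level
    [n_j] with the Fourier coefficients of [g] for [mu] gives
    [eps ||g||^2 <= 2 sum_{Lambda} |<g, e_l>|^2].  By density of such [g] and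
    Bessel's inequality a function orthogonal to [Lambda] vanishes. *)

Set Implicit Arguments. Unset Strict Implicit. Unset Printing Implicit Defensive.

(** * Characters of the circle and squared moduli *)

Section UnitCircle.
Variable R : realType.
Implicit Types (t s : R) (z w : R[i]).

Definition e1 t : R[i] := expi (2 * pi * t).

(** A real-valued squared modulus, so that the order of [R] applies; the norm of [R[i]] takes its
    values in [R[i]]. *)
Definition nsq z : R := complex.Re z ^+ 2 + complex.Im z ^+ 2.

Lemma expiD t s : expi (t + s) = expi t * expi s.
Proof.
by rewrite /expi cosD sinD; apply/eqP; rewrite eq_complex /= addrC [cos t * _ + _]addrC !eqxx.
Qed.

Lemma e1D t s : e1 (t + s) = e1 t * e1 s.
Proof. by rewrite /e1 mulrDr expiD. Qed.

Lemma e1_0 : e1 0 = 1.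
Proof. by rewrite /e1 mulr0 /expi cos0 sin0. Qed.

Lemma e1N t : e1 (- t) = conjc (e1 t).
Proof. by rewrite /e1 mulrN /expi cosN sinN. Qed.

Lemma e1_nat (n : nat) : e1 n%:R = 1.
Proof.
elim: n => [|n IHn]; first exact: e1_0.
rewrite -addn1 natrD e1D IHn mul1r /e1 mulr1 /expi.
by rewrite mulr_natl cos2pi sin2pi.
Qed.

Lemma e1_int (k : int) : e1 k%:~R = 1.
Proof.
case: k => n; first exact: e1_nat.
by rewrite NegzE mulrNz e1N e1_nat conjc1.
Qed.

Lemma e1_Dint t (k : int) : e1 (t + k%:~R) = e1 t.
Proof. by rewrite e1D e1_int mulr1. Qed.

Lemma nsq_ge0 z : 0 <= nsq z.
Proof. by rewrite addr_ge0 ?sqr_ge0. Qed.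

Lemma nsqM z w : nsq (z * w) = nsq z * nsq w.
Proof. by case: z => a b; case: w => c e; rewrite /nsq /=; ring. Qed.

Lemma nsq_e1 t : nsq (e1 t) = 1.
Proof. exact: cos2Dsin2. Qed.

Lemma nsqMe z t : nsq (z * e1 t) = nsq z.
Proof. by rewrite nsqM nsq_e1 mulr1. Qed.

Lemma nsq_eM z t : nsq (e1 t * z) = nsq z.
Proof. by rewrite mulrC nsqMe. Qed.

Lemma nsqR (a : R) : nsq (a%:C)%C = a ^+ 2.
Proof. by rewrite /nsq /= expr0n /= addr0. Qed.

Lemma nsqZ (a : R) z : nsq ((a%:C)%C * z) = a ^+ 2 * nsq z.
Proof. by rewrite nsqM nsqR. Qed.

Lemma nsq_eq0 z : nsq z = 0 -> z = 0.
Proof.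
case: z => a b /eqP; rewrite /nsq /= paddr_eq0 ?sqr_ge0 // !sqrf_eq0.
by move=> /andP[/eqP-> /eqP->].
Qed.

Lemma nsq_nat (n : nat) : nsq n%:R = n%:R ^+ 2.
Proof. by rewrite -nsqR rmorph_nat. Qed.

Lemma mulr_conjc z : z * conjc z = ((nsq z)%:C)%C.
Proof.
case: z => a b; rewrite /nsq; apply/eqP; rewrite eq_complex /=.
by apply/andP; split; apply/eqP; ring.
Qed.

(** The right side minus the left one is the squared modulus of [2 w - z]. *)
Lemma nsqB_le z w : nsq z <= 2 * nsq w + 2 * nsq (w - z).
Proof.
case: z => a b; case: w => c e; rewrite /nsq /=.
have := sqr_ge0 (2 * c - a); have := sqr_ge0 (2 * e - b); nra.
Qed.

Lemma Re_sqr_le z : complex.Re z ^+ 2 <= nsq z.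
Proof. by rewrite lerDl sqr_ge0. Qed.

Lemma Im_sqr_le z : complex.Im z ^+ 2 <= nsq z.
Proof. by rewrite lerDr sqr_ge0. Qed.

Lemma ReZ (a : R) z : complex.Re ((a%:C)%C * z) = a * complex.Re z.
Proof. by case: z => x y /=; rewrite mul0r subr0. Qed.

Lemma ImZ (a : R) z : complex.Im ((a%:C)%C * z) = a * complex.Im z.
Proof. by case: z => x y /=; rewrite mul0r addr0. Qed.

Lemma Re_sum (I : Type) (s : seq I) (F : I -> R[i]) :
  complex.Re (\sum_(i <- s) F i) = \sum_(i <- s) complex.Re (F i).
Proof. exact: raddf_sum. Qed.

Lemma Im_sum (I : Type) (s : seq I) (F : I -> R[i]) :
  complex.Im (\sum_(i <- s) F i) = \sum_(i <- s) complex.Im (F i).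
Proof. exact: raddf_sum. Qed.

Lemma sqr_sum_le (I : Type) (s : seq I) (F : I -> R) :
  (\sum_(i <- s) F i) ^+ 2 <= (size s)%:R * \sum_(i <- s) F i ^+ 2.
Proof.
elim: s => [|i s IHs]; first by rewrite !big_nil expr0n mulr0.
rewrite !big_cons /= -natr1.
(* Only the cross term of the expanded square is left, and [2 a b <= a ^ 2 + b ^ 2] bounds it term
   by term. *)
suff : 2 * F i * (\sum_(j <- s) F j) <=
    (size s)%:R * F i ^+ 2 + \sum_(j <- s) F j ^+ 2.
  move: IHs; set A := \sum_(j <- s) F j; set Q := \sum_(j <- s) F j ^+ 2.
  by move: (F i) (size s)%:R => a n *; nra.
elim: s {IHs} => [|j s IHs]; first by rewrite !big_nil mulr0 mul0r add0r.
rewrite !big_cons /= -natr1.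
have := sqr_ge0 (F i - F j); nra.
Qed.

Lemma nsq_sum_le (I : Type) (s : seq I) (F : I -> R[i]) :
  nsq (\sum_(i <- s) F i) <= (size s)%:R * \sum_(i <- s) nsq (F i).
Proof.
rewrite /nsq Re_sum Im_sum big_split /= mulrDr.
by apply: lerD; exact: sqr_sum_le.
Qed.

End UnitCircle.
Arguments e1 : simpl never.

(** * Parseval at a single level *)

Section OneLevel.
Variables (R : realType) (d : nat).
Implicit Types (m : 'I_d -> nat) (B L : seq 'rV[int]_d).

Lemma row_conj_normE n (v : 'rV[R[i]]_n) :
  (v *m (map_mx conjc v)^T) 0 0 = ((\sum_k nsq (v 0 k))%:C)%C.
Proof.
rewrite mxE rmorph_sum /=; apply: eq_bigr => k _.
by rewrite !mxE mulr_conjc.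
Qed.

Lemma unitary_isometry n (U : 'M[R[i]]_n) (v : 'rV[R[i]]_n) : unitary_mx U ->
  \sum_k nsq ((v *m U) 0 k) = \sum_k nsq (v 0 k).
Proof.
move=> [_ UU]; apply: (@complexI R).
rewrite -!row_conj_normE map_mxM trmx_mul mulmxA -(mulmxA v) UU mulmx1.
by [].
Qed.

(** Admissibility enters the rest of the proof only through this unnormalised Parseval identity for
    functions on the digits. *)
Definition level_parseval m B L : Prop := forall h : 'rV[int]_d -> R[i],
  \sum_(l <- L) nsq (\sum_(b <- B) h b * e1 (- Rinv_dot R m b l)) =
  (size B)%:R * \sum_(b <- B) nsq (h b).

Lemma admissible_parseval m B : (0 < size B)%N -> admissible R m B ->
  exists L, level_parseval m B L /\ size L = size B.
Proof.
move=> B0 [L [_ [sL UL]]]; exists L; split => // h.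
pose v : 'rV[R[i]]_(size B) := \row_j h (nth 0 B j).
have := unitary_isometry v UL.
have -> : \sum_k nsq (v 0 k) = \sum_(b <- B) nsq (h b).
  by rewrite (big_nth 0) big_mkord; apply: eq_bigr => j _; rewrite mxE.
move=> <-; rewrite (big_nth 0) sL big_mkord big_distrr /=.
apply: eq_bigr => k _; rewrite !mxE.
have -> : \sum_j v 0 j * adm_matrix R m B L j k =
   (((Num.sqrt (size B)%:R)^-1)%:C)%C *
     \sum_(b <- B) h b * e1 (- Rinv_dot R m b (nth 0 L k)).
  rewrite (big_nth 0) big_mkord big_distrr /=; apply: eq_bigr => j _.
  by rewrite !mxE /e1 mulrN; ring.
rewrite nsqZ exprVn sqr_sqrtr ?ler0n // mulrA mulfV ?mul1r //.
by rewrite pnatr_eq0 -lt0n.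
Qed.

Lemma Rinv_dotBr m b l l' :
  Rinv_dot R m b (l - l') = Rinv_dot R m b l - Rinv_dot R m b l'.
Proof.
by rewrite /Rinv_dot -sumrB; apply: eq_bigr => i _; rewrite !mxE intrB mulrBr.
Qed.

(** Replacing [L] by [L - l0] amounts to multiplying [h] by a unimodular character, which leaves
    each [nsq (h b)] unchanged. Having [0] among the frequencies is what makes the sets of
    successive levels nested. *)
Lemma admissible_parseval0 m B : (0 < size B)%N -> admissible R m B ->
  exists L, level_parseval m B L /\ 0 \in L.
Proof.
move=> B0 /(admissible_parseval B0) [L [HL sL]].
pose l0 := nth 0 L 0.
have l0L : l0 \in L by rewrite mem_nth // sL.
exists [seq l - l0 | l <- L]; split; last by apply/mapP; exists l0; rewrite ?subrr.
move=> h; rewrite big_map.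
have := HL (fun b => h b * e1 (Rinv_dot R m b l0)).
under [in X in _ = X -> _]eq_bigr do rewrite nsqMe.
move=> <-; apply: eq_bigr => l _; congr nsq; apply: eq_bigr => b _.
by rewrite Rinv_dotBr opprB e1D mulrA.
Qed.

End OneLevel.

Lemma sum_const_seq (V : nmodType) (I : Type) (s : seq I) (c : V) :
  \sum_(i <- s) c = c *+ size s.
Proof. by rewrite big_const_seq count_predT iter_addr_0. Qed.

Lemma sum_lt_const (R : realType) (I : eqType) (s : seq I) (F : I -> R) (c : R) :
  (0 < size s)%N -> (forall i, i \in s -> F i < c) ->
  \sum_(i <- s) F i < c *+ size s.
Proof.
rewrite -sum_const_seq; case: s => // i s _ H; rewrite !big_cons.
apply: ltr_leD; first by apply: H; rewrite mem_head.
rewrite big_seq [leRHS]big_seq; apply: ler_sum => j js; apply/ltW/H.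
by rewrite in_cons js orbT.
Qed.

(** * A nonnegative trigonometric kernel *)

Section TrigKernel.
Variable R : realType.

Lemma e1X (t : R) n : e1 (t *+ n) = e1 t ^+ n.
Proof.
by elim: n => [|n IHn]; rewrite ?mulr0n ?e1_0 // mulrS e1D IHn exprS.
Qed.

Lemma cosC_e1 (s : R) :
  ((cos (pi * s))%:C)%C = ((2^-1 : R)%:C)%C * (e1 (s / 2) + e1 (- (s / 2))).
Proof.
rewrite e1N /e1 (_ : 2 * pi * (s / 2) = pi * s); last by field.
rewrite /expi; apply/eqP; rewrite eq_complex /=.
by apply/andP; split; apply/eqP; field.
Qed.

(** Fourier coefficient of [cos (pi s) ^ (2 r)] at the frequency [r - j]. *)
Definition wt r j : R := 'C(r.*2, j)%:R / 4 ^+ r.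

Lemma wt_ge0 r j : 0 <= wt r j.
Proof. by rewrite divr_ge0 ?ler0n ?exprn_ge0. Qed.

Lemma cos_expand r (s : R) : (((cos (pi * s) ^+ 2) ^+ r)%:C)%C =
  \sum_(j < r.*2.+1) ((wt r j)%:C)%C * e1 ((r%:R - j%:R) * s).
Proof.
rewrite -exprM mul2n rmorphXn /= cosC_e1 exprMn exprDn big_distrr /=.
apply: eq_bigr => j _; rewrite -!e1X -e1D /wt.
have -> : s / 2 *+ (r.*2 - j) + - (s / 2) *+ j = (r%:R - j%:R) * s.
  have jr : (j <= r.*2)%N by rewrite -ltnS.
  rewrite -(mulr_natr (s / 2)) -(mulr_natr (- (s / 2))) natrB //.
  have -> : r.*2%:R = 2 * r%:R :> R by rewrite -mul2n natrM.
  by field.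
rewrite mulrnAr -mulrnAl; congr (_ * _).
rewrite rmorphM rmorph_nat /= mulr_natl; congr (_ *+ _).
rewrite -rmorphXn /= -muln2 mulnC exprM; congr (_%:C)%C.
by rewrite -exprVn; congr (_ ^+ _); field.
Qed.

Variable d : nat.
Implicit Types (s x q : 'I_d -> R).

(** A product kernel, 1-periodic in each coordinate, with maximum 1 on the integer lattice and
    nonnegative Fourier coefficients; away from the lattice it decays geometrically in [r]. *)
Definition psi r s : R := \prod_i (cos (pi * s i) ^+ 2) ^+ r.

(** Indices [0, ..., 2 r] encode the frequencies [-r, ..., r]. *)
Definition freq r (f : {ffun 'I_d -> 'I_(r.*2.+1)}) (i : 'I_d) : int :=
  (f i)%:Z - r%:Z.

Definition fwt r (f : {ffun 'I_d -> 'I_(r.*2.+1)}) : R := \prod_i wt r (f i).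

Lemma fwt_ge0 r f : 0 <= @fwt r f.
Proof. by apply: prodr_ge0 => i _; exact: wt_ge0. Qed.

Lemma e1_sum (I : Type) (l : seq I) (F : I -> R) :
  e1 (\sum_(i <- l) F i) = \prod_(i <- l) e1 (F i).
Proof.
elim: l => [|a l IHl]; first by rewrite !big_nil e1_0.
by rewrite !big_cons e1D IHl.
Qed.

Lemma psi_expand r s :
  ((psi r s)%:C)%C =
  \sum_(f : {ffun 'I_d -> 'I_(r.*2.+1)})
    ((fwt f)%:C)%C * e1 (- \sum_i (freq f i)%:~R * s i) :> R[i].
Proof.
rewrite /psi rmorph_prod /=.
under eq_bigr do rewrite cos_expand.
rewrite bigA_distr_bigA /=; apply: eq_bigr => f _.
rewrite big_split /= /fwt rmorph_prod; congr (_ * _).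
rewrite -sumrN e1_sum; apply: eq_bigr => i _; congr e1.
by rewrite /freq intrB -!pmulrn; ring.
Qed.

Lemma psi_ge0 r s : 0 <= psi r s.
Proof. by apply: prodr_ge0 => i _; rewrite exprn_ge0 // sqr_ge0. Qed.

Lemma psi0 r : psi r (fun=> 0) = 1.
Proof. by rewrite /psi big1 // => i _; rewrite mulr0 cos0 !expr1n. Qed.

(** Evaluate the Fourier expansion of [psi] at [0]. *)
Lemma fwt_sum r : \sum_f @fwt r f = 1.
Proof.
apply: (@complexI R); rewrite -(psi0 r) psi_expand rmorph_sum /=.
apply: eq_bigr => f _; rewrite (_ : \sum_i _ = 0) ?oppr0 ?e1_0 ?mulr1 //.
by rewrite big1 // => i _; rewrite mulr0.
Qed.

Lemma psi_le_factor r s i : psi r s <= (cos (pi * s i) ^+ 2) ^+ r.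
Proof.
rewrite /psi (bigD1 i) //= ler_piMr //; first by rewrite exprn_ge0 // sqr_ge0.
apply: Num.Theory.prodr_ile1 => j _; rewrite exprn_ge0 ?sqr_ge0 //=.
by rewrite exprn_ile1 ?sqr_ge0 // -real_normK ?num_real // exprn_ile1 // cos_max.

Qed.

(* Averaging over the frequencies of [psi]: its Fourier weights form a
   probability vector. *)
Lemma freq_extraction r (I : Type) (J : seq I) (u : I -> 'I_d -> R) x q (a : R) :
  0 <= a ->
  a <= \sum_(j <- J) psi r (fun i => u j i - q i)
                     * cos (2 * pi * \sum_i x i * (u j i - q i)) ->
  exists f : {ffun 'I_d -> 'I_(r.*2.+1)},
    a ^+ 2 <= nsq (\sum_(j <- J) e1 (- \sum_i (x i + (freq f i)%:~R) * u j i)).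
Proof.
move=> a0 aF.
pose z (f : {ffun 'I_d -> 'I_(r.*2.+1)}) : R[i] :=
  \sum_(j <- J) e1 (- \sum_i (x i + (freq f i)%:~R) * (u j i - q i)).
(* Recentring at [q] multiplies the whole sum by one unimodular factor. *)
have zE f : nsq (z f) = nsq (\sum_(j <- J) e1 (- \sum_i (x i + (freq f i)%:~R) * u j i)).
  rewrite -(nsqMe _ (- \sum_i (x i + (freq f i)%:~R) * q i)) mulr_suml.
  congr nsq; apply: eq_bigr => j _; rewrite -e1D; congr e1.
  by rewrite -!sumrN -big_split /=; apply: eq_bigr => i _; ring.
have FE : \sum_(j <- J) psi r (fun i => u j i - q i)
                     * cos (2 * pi * \sum_i x i * (u j i - q i)) =
          \sum_(f : {ffun 'I_d -> 'I_(r.*2.+1)}) fwt f * complex.Re (z f).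
  rewrite (_ : \sum_f _ = complex.Re (\sum_f ((fwt f)%:C)%C * z f)); last first.
    by rewrite Re_sum; apply: eq_bigr => f _; rewrite ReZ.
  under [in RHS]eq_bigr do rewrite big_distrr /=.
  rewrite exchange_big /= Re_sum; apply: eq_bigr => j _.
  pose y := e1 (- \sum_i x i * (u j i - q i)).
  rewrite (_ : \sum_f _ = ((psi r (fun i => u j i - q i))%:C)%C * y).
    by rewrite ReZ /y /e1 /= mulrN cosN.
  rewrite psi_expand big_distrl /=; apply: eq_bigr => f _.
  rewrite -mulrA -e1D; congr (_ * e1 _).
  by rewrite -!sumrN -big_split /=; apply: eq_bigr => i _; ring.
(* [f0] only supplies an element for the choice of a maximum; the maximal real part dominates the
   average with weights [fwt]. *)
pose f0 : {ffun 'I_d -> 'I_(r.*2.+1)} := [ffun=> ord0].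
case: (@Order.TotalTheory.arg_maxP _ _ _ f0 xpredT (fun f => complex.Re (z f)) isT) => f _ fmax.
have az : a <= complex.Re (z f).
  rewrite (le_trans aF) // FE -[leRHS]mul1r -(fwt_sum r) mulr_suml.
  by apply: ler_sum => g _; rewrite ler_wpM2l ?fwt_ge0 //; exact: fmax.
exists f; rewrite -zE; apply: le_trans (Re_sqr_le _).
by rewrite ler_pXn2r // nnegrE // (le_trans a0).
Qed.

(** By Vandermonde, [C(2r, r)] is the sum of the [r + 1] squares [C(r, j) ^ 2], and Cauchy-Schwarz
    compares it with the square of the sum [2 ^ r] of the [C(r, j)]. *)
Lemma wt_mid_ge r : (r.+1)%:R^-1 <= wt r r.
Proof.
rewrite /wt ler_pdivlMr ?exprn_gt0 // mulrC ler_pdivrMr ?ltr0n //.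
have -> : (4 : R) ^+ r = (\sum_(j < r.+1) ('C(r, j)%:R : R)) ^+ 2.
  rewrite (_ : \sum_(j < r.+1) _ = (2 : R) ^+ r).
    by rewrite -exprM mulnC exprM; congr (_ ^+ _); ring.
  rewrite (_ : 2 = 1 + 1) // exprDn; apply: eq_bigr => j _.
  by rewrite !expr1n mulr1.
apply: le_trans (sqr_sum_le _ _) _.
rewrite /index_enum -enumT size_enum_ord mulrC ler_wpM2r //.
rewrite -addnn -binomial.Vandermonde natr_sum big_enum /=.
by apply: ler_sum => j _; rewrite natrM bin_sub ?expr2 // -ltnS.
Qed.

(* [psi r] is positive definite, so the double average is at least the weight
   of the zero frequency. *)
Lemma psi_concentration r (I : eqType) (T : seq I) (w : I -> 'I_d -> R) :
  (0 < size T)%N -> exists2 t0, t0 \in T &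
  (size T)%:R * (r.+1)%:R^-1 ^+ d <= \sum_(t <- T) psi r (fun i => w t i - w t0 i).
Proof.
move=> T0; set c := _^-1 ^+ d; apply/exists2P; apply: contrapT => /forallNP H.
have {}H t0 : t0 \in T ->
    \sum_(t <- T) psi r (fun i => w t i - w t0 i) < (size T)%:R * c.
  by move=> t0T; rewrite ltNge; apply/negP => h; apply: (H t0).
pose S := \sum_(t0 <- T) \sum_(t <- T) psi r (fun i => w t i - w t0 i).
have : S < (size T)%:R * ((size T)%:R * c).
  rewrite mulr_natl; exact: sum_lt_const.
apply/negP; rewrite -leNgt mulrA -expr2.
have SE : S = \sum_(f : {ffun 'I_d -> 'I_(r.*2.+1)}) fwt f *
    nsq (\sum_(t <- T) e1 (- \sum_i (freq f i)%:~R * w t i)) :> R.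
  apply: (@complexI R); rewrite rmorph_sum [in RHS]rmorph_sum /=.
  under eq_bigr => t0 _.
    rewrite rmorph_sum /=; under eq_bigr do rewrite psi_expand.
    rewrite exchange_big /=; over.
  rewrite exchange_big /=; apply: eq_bigr => f _.
  rewrite [in RHS]rmorphM /= -mulr_conjc rmorph_sum /= big_distrlr /= exchange_big.
  rewrite [in RHS]big_distrr /=; apply: eq_bigr => t _; rewrite [in RHS]big_distrr /=.
  apply: eq_bigr => t0 _; congr (_ * _).
  rewrite -[X in _ = _ * X]/(conjc (e1 _)) -e1N -e1D; congr e1.
  by rewrite opprK -!sumrN -big_split /=; apply: eq_bigr => i _; ring.
have mid : (r < r.*2.+1)%N by rewrite ltnS -addnn leq_addr.
(* The constant index [r] encodes the zero frequency; all other terms are dropped as nonnegative. *)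
rewrite SE (bigD1 [ffun=> Ordinal mid]) //= -[leLHS]addr0; apply: lerD; last first.
  by apply: sumr_ge0 => f _; rewrite mulr_ge0 ?fwt_ge0 ?nsq_ge0.
rewrite (_ : \sum_(t <- T) _ = (size T)%:R) ?nsq_nat; last first.
  rewrite (eq_bigr (fun=> 1)); first by rewrite sum_const_seq.
  move=> t _; rewrite big1 ?oppr0 ?e1_0 // => i _.
  by rewrite /freq ffunE /= subrr mul0r.
rewrite mulrC ler_wpM2r ?sqr_ge0 // /c /fwt.
rewrite (eq_bigr (fun=> wt r r)); last by move=> i _; rewrite ffunE.
rewrite prodr_const card_ord; apply: lerXn2r; rewrite ?nnegrE ?wt_ge0 ?invr_ge0 //.
exact: wt_mid_ge.
Qed.

End TrigKernel.

(** * Equipositivity of the tail transforms *)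

Section Equipositivity.
Variable R : realType.

(** Induction on [d] with [sg] the square root of [rho]: each step trades one power of [r + 1] for a
    factor [sg ^ r], since [(r + 1) sg ^ r] is at most a partial geometric sum, hence at most
    [1 / (1 - sg)]. *)
Lemma polyexp_bounded (d : nat) (rho : R) : 0 <= rho < 1 ->
  exists C : R, forall r : nat, r.+1%:R ^+ d * rho ^+ r <= C.
Proof.
elim: d rho => [|d IHd] rho /andP[r0 r1].
  by exists 1 => r; rewrite expr0 mul1r exprn_ile1 // ltW.
pose sg := Num.sqrt rho.
have sg0 : 0 <= sg by exact: sqrtr_ge0.
have sg1 : sg < 1 by rewrite -[1]sqrtr1 ltr_sqrt.
have [|C HC] := IHd sg; first by rewrite sg0.
exists (C / (1 - sg)) => r.
have -> : r.+1%:R ^+ d.+1 * rho ^+ r = (r.+1%:R ^+ d * sg ^+ r) * (r.+1%:R * sg ^+ r).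
  by rewrite -[rho]sqr_sqrtr // -/sg -exprM mulnC exprM exprS; ring.
apply: ler_pM => //; rewrite ?mulr_ge0 ?exprn_ge0 //.
rewrite -[leRHS]mul1r ler_pdivlMr ?subr_gt0 //.
have /esym E := subrX1 sg r.+1.
have : r.+1%:R * sg ^+ r <= \sum_(i < r.+1) sg ^+ i.
  rewrite mulr_natl -[in leLHS](card_ord r.+1) -sumr_const.
  apply: ler_sum => i _; apply: ler_wiXn2l; rewrite ?(ltW sg1) //.
  by rewrite -ltnS.
have : 0 <= sg ^+ r.+1 by rewrite exprn_ge0.
move: E; set S := \sum_(i < _) _; set X := _ * sg ^+ r; set Y := sg ^+ r.+1.
by nra.
Qed.

(** Writing [rho = sg ^ 2], one factor [sg ^ r] absorbs the polynomial and the other tends to 0. *)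
Lemma polyexp_small (d : nat) (rho c : R) : 0 <= rho < 1 -> 0 < c ->
  exists r : nat, r.+1%:R ^+ d * rho ^+ r < c.
Proof.
move=> /andP[r0 r1] c0; pose sg := Num.sqrt rho.
have sg0 : 0 <= sg by exact: sqrtr_ge0.
have sg1 : sg < 1 by rewrite -[1]sqrtr1 ltr_sqrt.
have [|C HC] := @polyexp_bounded d sg; first by rewrite sg0.
pose C' := `|C| + 1.
have C'0 : 0 < C' by rewrite ltr_wpDl.
have /cvgrPdist_lt/(_ (c / C')) : (fun r => sg ^+ r) @ \oo --> (0 : R).
  by apply: cvg_expr; rewrite ger0_norm.
rewrite divr_gt0 // => /(_ isT) [r _ /(_ r (leqnn r))].
rewrite /= sub0r normrN ger0_norm ?exprn_ge0 // ltr_pdivlMr // => H.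
exists r; apply: le_lt_trans H.
rewrite -[rho]sqr_sqrtr // -/sg -exprM mulnC exprM expr2 mulrA mulrC.
apply: ler_wpM2l; rewrite ?exprn_ge0 //.
by rewrite (le_trans (HC r)) // /C' (le_trans (ler_norm _)) // lerDl.
Qed.

Lemma cos_ge_half : exists2 th : R, 0 < th &
  forall t : R, `|t| <= th -> 2^-1 <= cos t.
Proof.
have /cvgrPdist_lt/(_ 2^-1) := @continuous_cos R 0.
rewrite invr_gt0 ltr0n => /(_ isT) /nbhs_ballP [e /= e0 He].
exists (e / 2); first by rewrite divr_gt0.
move=> t te; have := He t; rewrite /ball /= sub0r normrN cos0 => /(_ _).
rewrite (le_lt_trans te) => [/(_ isT)|]; last by rewrite ltr_pdivrMr // ltr_pMr // ltr1n.
by rewrite ltr_distlC => /andP[h _]; move: h; lra.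
Qed.

Lemma cos2_e1 (s : R) : cos (pi * s) ^+ 2 = (1 + complex.Re (e1 s)) / 2.
Proof.
rewrite /e1 /= (_ : 2 * pi * s = (pi * s) *+ 2) ?cos_mulr2n; last by ring.
by field.
Qed.

Lemma cos2_gt_near_int (th s : R) : 0 < th <= 2^-1 ->
  cos (pi * th) ^+ 2 < cos (pi * s) ^+ 2 -> exists z : int, `|s - z%:~R| < th.
Proof.
(* The nearest integer: [cos (pi s) ^ 2] depends only on the distance to it and decreases in that
   distance on [[0, 1/2]]. *)
move=> /andP[th0 th1] H; exists (Num.floor (s + 2^-1)).
have := floor_itv (s + 2^-1); set z := Num.floor _.
rewrite intrD => /andP[zl zr].
have E : cos (pi * s) ^+ 2 = cos (pi * `|s - z%:~R|) ^+ 2.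
  have -> : cos (pi * `|s - z%:~R|) = cos (pi * (s - z%:~R)).
    by rewrite -[RHS]cos_norm normrM (ger0_norm (pi_ge0 R)).
  by rewrite !cos2_e1 -mulrNz e1_Dint.
move: H; rewrite E; set u := `|_| => H; rewrite ltNge; apply/negP => thu.
have u1 : u <= 2^-1 by rewrite /u ler_norml; lra.
have p0 := pi_gt0 R.
have cu0 : 0 <= cos (pi * u).
  by apply: cos_ge0_pihalf; apply/andP; split; nra.
have : cos (pi * u) <= cos (pi * th).
  by rewrite leNgt ltr_cos ?in_itv /= ?ltr_pM2l // -?leNgt //; apply/andP; split; nra.
by move: H; nra.
Qed.

Variable d : nat.
Implicit Types (m : 'I_d -> nat) (b : 'rV[int]_d).

(** The threshold 1/2 fixes the sign of the carry in [no_wrap]: with errors below 1/4 the carry is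
    [-1] or [0] when [t0 i <= 1/2], and [0] or [1] otherwise. *)
Definition sgn_of (t : R) : int := if t <= 2^-1 then -1 else 1.

Definition height m (t : 'rV[R]_d) b : R :=
  \sum_i (sgn_of (t 0 i) * b 0 i)%:~R / (m i)%:R.

(* A wrap-around by [m z] costs at least [1] in [height], while the carry
   [b - b0 - m z], a vector with entries in {0, sgn}, gains at most
   [d / (d + 1)]. *)
Lemma no_wrap m (b0 b : 'rV[int]_d) (t0 t : 'rV[R]_d) (z : 'I_d -> int) :
  (forall i, (d.+1 <= m i)%N) ->
  (forall i, 0 <= b0 0 i < (m i)%:Z) -> (forall i, 0 <= b 0 i < (m i)%:Z) ->
  (forall i, 0 <= t0 0 i <= 1) -> (forall i, 0 <= t 0 i <= 1) ->
  height m t0 b0 <= height m t0 b ->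
  (forall i, `|(b 0 i)%:~R + t 0 i - ((b0 0 i)%:~R + t0 0 i)
               - (m i)%:R * (z i)%:~R| < 4^-1) ->
  forall i, z i = 0.
Proof.
move=> dm b0m bm t01 t1 hb near.
pose D i := b 0 i - b0 0 i - (m i)%:Z * z i.
pose sg i := sgn_of (t0 0 i).
have DE i : (D i)%:~R = (b 0 i)%:~R - (b0 0 i)%:~R - (m i)%:R * (z i)%:~R :> R.
  by rewrite /D !intrB intrM -pmulrn.
have sD i : 0 <= sg i * D i <= 1.
  have := near i; rewrite ltr_norml => /andP[n1 n2].
  have /andP[t2 t3] := t01 i; have /andP[t4 t5] := t1 i.
  rewrite /sg /sgn_of; case: ifPn => [th|]; last rewrite -ltNge => th.
  - have : (D i)%:~R < 1%:~R :> R by rewrite DE; lra.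
    have : (-2)%:~R < (D i)%:~R :> R by rewrite DE; lra.
    by rewrite !ltr_int; lia.
  - have : (D i)%:~R < 2%:~R :> R by rewrite DE; lra.
    have : (-1)%:~R < (D i)%:~R :> R by rewrite DE; lra.
    by rewrite !ltr_int; lia.
(* From [0 <= sg D] one gets [m (sg z) <= sg (b - b0) < m], so the integer [sg z] is below 1. *)
have sz i : sg i * z i <= 0.
  have := sD i; have := b0m i; have := bm i; have := dm i.
  rewrite /D /sg /sgn_of; case: ifP => _; move: (m i) (z i) (b 0 i) (b0 0 i) => M Z u v.
    by rewrite !mulN1r => *; nia.
  by rewrite !mul1r => *; nia.
have m0 i : 0 < (m i)%:R :> R by rewrite ltr0n (leq_trans _ (dm i)).
have hE : height m t0 b - height m t0 b0 =
    \sum_i (sg i * D i)%:~R / (m i)%:R + \sum_i (sg i * z i)%:~R.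
  rewrite /height -sumrB -big_split /=; apply: eq_bigr => i _.
  by rewrite !intrM DE -/(sg i); field; rewrite gt_eqF.
(* Each carry contributes at most [1 / m_i <= 1 / (d + 1)], so the sum is at most [d / (d + 1)]. *)
have hD : \sum_i (sg i * D i)%:~R / (m i)%:R < 1 :> R.
  apply: (@le_lt_trans _ _ (\sum_(i < d) (d.+1)%:R^-1)).
    apply: ler_sum => i _; have /andP[d0 d1] := sD i.
    apply: (@le_trans _ _ ((m i)%:R^-1)).
      rewrite -[leRHS]mul1r ler_pM2r ?invr_gt0 //.
      by rewrite -[1]/(1%:~R) ler_int.
    by rewrite lef_pV2 ?posrE ?m0 ?ltr0n // ler_nat.
  rewrite sumr_const card_ord -[_^-1 *+ _]mulr_natl ltr_pdivrMr ?ltr0n // mul1r ltr_nat.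
  exact: ltnSn.
move=> i.
(* Comparing heights forces [sum_j sg_j z_j > -1]; all terms are integers at most 0, so each of them
   vanishes. *)
have : \sum_j (sg j * z j)%:~R <= (sg i * z i)%:~R :> R.
  rewrite (bigD1 i) //= gerDl; apply: sumr_le0 => j _.
  by rewrite -[0]/(0%:~R) ler_int.
move=> Hi; have : (-1)%:~R < (sg i * z i)%:~R :> R.
  rewrite mulrNz mulr1z; move: hE hb hD Hi; lra.
rewrite ltr_int => h1; have := sz i; move: h1.
by rewrite /sg /sgn_of; case: ifP => _; lia.
Qed.

(** [eps] and [r] depend only on [m] and [C], which makes the estimate uniform over levels and
    tails. The constants are fixed in turn: the radius [eta], the decay rate [rho] outside it, then
    [r] so large that [rho ^ r] is negligible against the mass [w] from [psi_concentration]. *)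
Lemma equipositivity m (C : nat) : (forall i, (d.+1 <= m i)%N) ->
  exists2 eps : R, 0 < eps & exists r : nat,
  forall (B : seq 'rV[int]_d) (T : seq 'rV[R]_d) (x : 'I_d -> R),
    (0 < size B <= C)%N -> (forall b, b \in B -> forall i, 0 <= b 0 i < (m i)%:Z) ->
    (0 < size T)%N -> (forall t, t \in T -> forall i, 0 <= t 0 i <= 1) ->
    (forall i, 0 <= x i <= 1) ->
    exists f : {ffun 'I_d -> 'I_(r.*2.+1)},
      eps * ((size B)%:R * (size T)%:R) ^+ 2 <=
      nsq (\sum_(b <- B) \sum_(t <- T)
        e1 (- \sum_i (x i + (freq f i)%:~R) * (((b 0 i)%:~R + t 0 i) / (m i)%:R))).
Proof.
move=> dm; have m0 i : 0 < (m i)%:R :> R by rewrite ltr0n (leq_trans _ (dm i)).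
have [th th0 Hth] := cos_ge_half.
have p0 := pi_gt0 R.
(* [1/4] is the tolerance of [no_wrap]; the other bound keeps a phase [2 pi sum_i x_i s_i], with [d]
   terms of size at most [eta], within [th]. *)
pose eta := Num.min (4^-1) (th / (2 * pi * d.+1%:R)).
have eta0 : 0 < eta by rewrite lt_min invr_gt0 ltr0n /= divr_gt0 ?mulr_gt0.
have eta4 : eta <= 4^-1 by rewrite ge_min lexx.
have etath : 2 * pi * (d.+1%:R * eta) <= th.
  rewrite mulrA mulrC -ler_pdivlMr ?mulr_gt0 //.
  by rewrite ge_min lexx orbT.
pose M : R := 1 + \sum_i (m i)%:R.
have mM i : (m i)%:R <= M.
  rewrite /M (bigD1 i) //= addrCA lerDl addr_ge0 //.
  by apply: sumr_ge0.
have M1 : 1 <= M by rewrite lerDl sumr_ge0.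
(* Points are divided by [m_i <= M] before being compared modulo 1, hence the smaller radius. *)
pose th' := eta / M.
have M0 : 0 < M by rewrite (lt_le_trans _ M1).
have th'0 : 0 < th' by rewrite divr_gt0.
have th'2 : th' <= 4^-1.
  by rewrite ler_pdivrMr // (le_trans eta4) // ler_peMr.
pose rho := cos (pi * th') ^+ 2.
have rho0 : 0 <= rho by rewrite sqr_ge0.
have rho1 : rho < 1.
  have c0 : 0 <= cos (pi * th').
    by apply: cos_ge0_pihalf; apply/andP; split; nra.
  have : cos (pi * th') < cos 0.
    have a0 : 0 < pi * th' by rewrite mulr_gt0.
    have a1 : pi * th' <= pi by nra.
    by rewrite ltr_cos // in_itv /= ?lexx ?pi_ge0 // ltW.
  by rewrite cos0 /rho; nra.
have C0 : C.+1%:R != 0 :> R by rewrite pnatr_eq0.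
(* The constants match: [rho ^ r < w c] gives [3/2 rho ^ r <= w / (4 (C + 1)) = del], and
   [size B <= C] gives [2 del (size B) <= w / 2]. *)
pose c : R := (6 * C.+1%:R)^-1.
have c0 : 0 < c by rewrite invr_gt0 mulr_gt0.
have [|r Hr] := @polyexp_small d rho c _ c0; first by rewrite rho0.
pose w : R := r.+1%:R^-1 ^+ d.
have w0 : 0 < w by rewrite exprn_gt0 // invr_gt0 ltr0n.
pose del : R := w / (4 * C.+1%:R).
have del0 : 0 < del by rewrite divr_gt0 // mulr_gt0.
have rhor : 3 / 2 * rho ^+ r <= del.
  move: Hr; rewrite -ltr_pdivlMl ?exprn_gt0 // -exprVn -/w => Hr.
  rewrite /del (_ : w / (4 * C.+1%:R) = 3 / 2 * (w * c)).
    by rewrite ler_pM2l ?divr_gt0 // ltW.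
  rewrite /c; move: C0; move: (C.+1%:R : R) => K K0; by field.
exists (del ^+ 2); first by rewrite exprn_gt0.
exists r => B T x /andP[B0 BC] Bm T0 T1 x1.
pose wT (t : 'rV[R]_d) i : R := t 0 i / (m i)%:R.
have [t0 t0T Ht0] := @psi_concentration R d r _ T wT T0.
have [b0 b0B Hb0] : exists2 b0, b0 \in B &
    forall b, b \in B -> height m t0 b0 <= height m t0 b.
  pose i0 : 'I_(size B) := Ordinal B0.
  case: (@Order.TotalTheory.arg_minP _ _ _ i0 xpredT
    (fun i : 'I_(size B) => height m t0 (nth 0 B i)) isT) => i _ imin.
  exists (nth 0 B i); first exact: mem_nth.
  by move=> b /(nthP 0) [j jB <-]; exact: (imin (Ordinal jB)).
pose u (j : 'rV[int]_d * 'rV[R]_d) i : R := ((j.1 0 i)%:~R + j.2 0 i) / (m i)%:R.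
pose q i : R := u (b0, t0) i.
pose J := [seq (b, t) | b <- B, t <- T].
(* A small [psi] is covered by [del], using only [cos >= -1]. A large one forces every [s i] near an
   integer, which [no_wrap] shows to be [0], so the cosine is at least 1/2. *)
have Hterm j : j \in J ->
    psi r (fun i => u j i - q i) / 2 - del <=
    psi r (fun i => u j i - q i) * cos (2 * pi * \sum_i x i * (u j i - q i)).
  case: j => b t /allpairsP [[b' t'] /= [bB tT [-> ->]]] {b t}.
  set b := b' in bB *; set t := t' in tT *.
  set s := fun i => _; set y := 2 * pi * _.
  have ps0 : 0 <= psi r s := psi_ge0 r s.
  have [small|big] := leP (psi r s) (rho ^+ r).
    have h : 0 <= psi r s * (cos y + 1).
      by rewrite mulr_ge0 //; have := cos_geN1 y; lra.
    move: rhor small ps0 h; rewrite mulrDr mulr1.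
    move: (psi r s * cos y) (psi r s) (rho ^+ r) => A P Q; lra.
  suff c2 : 2^-1 <= cos y.
    have := ler_wpM2l ps0 c2; move: del0.
    move: (psi r s * cos y) (psi r s) => A P; lra.
  have near i : exists z : int, `|s i - z%:~R| < th'.
    apply: cos2_gt_near_int; first by rewrite th'0 /=; lra.
    rewrite -/rho ltNge; apply/negP => le_rho.
    have := psi_le_factor r s i; apply/negP; rewrite -ltNge.
    apply: le_lt_trans big; apply: lerXn2r => //; rewrite nnegrE //.
    exact: sqr_ge0.
  have {near} [z near] := fin_all_exists near.
  have near' i : `|(b 0 i)%:~R + t 0 i - ((b0 0 i)%:~R + t0 0 i)
               - (m i)%:R * (z i)%:~R| < eta.
    have -> : (b 0 i)%:~R + t 0 i - ((b0 0 i)%:~R + t0 0 i) - (m i)%:R * (z i)%:~R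
       = (m i)%:R * (s i - (z i)%:~R).
      by rewrite /s /q /u /=; field; rewrite gt_eqF.
    rewrite normrM gtr0_norm // (lt_le_trans (y := (m i)%:R * th')) ?ltr_pM2l //.
    by rewrite /th' mulrCA ler_piMr ?(ltW eta0) // ler_pdivrMr // mul1r.
  have z0 : forall i, z i = 0.
    apply: (@no_wrap m b0 b t0 t) => //.
    - exact: Bm.
    - exact: Bm.
    - exact: T1.
    - exact: T1.
    - exact: Hb0.
    - by move=> i; apply: lt_le_trans (near' i) _.
  apply: Hth; rewrite /y normrM ger0_norm ?mulr_ge0 ?pi_ge0 //.
  apply: le_trans etath; rewrite ler_pM2l ?mulr_gt0 //.
  apply: le_trans (ler_norm_sum _ _ _) _.
  apply: (@le_trans _ _ (\sum_(i < d) eta)).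
    apply: ler_sum => i _; rewrite normrM; have /andP[x0 x1'] := x1 i.
    rewrite (ger0_norm x0) (le_trans (ler_piMl _ x1')) //.
    have := near i; rewrite z0 subr0 => /ltW /le_trans; apply.
    by rewrite /th' ler_piMr ?(ltW eta0) // invf_le1.
  rewrite sumr_const card_ord -[eta *+ _]mulr_natl ler_wpM2r ?(ltW eta0) //.
  by rewrite ler_nat.
have BT0 : 0 < (size B)%:R * (size T)%:R :> R by rewrite mulr_gt0 ?ltr0n.
have [|f Hf] := @freq_extraction R d r _ J u x q
   (del * ((size B)%:R * (size T)%:R)) (mulr_ge0 (ltW del0) (ltW BT0)).
  apply: (@le_trans _ _ (\sum_(j <- J) (psi r (fun i => u j i - q i) / 2 - del)));
    last by rewrite big_seq [leRHS]big_seq; exact: ler_sum.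
  rewrite sumrB sum_const_seq size_allpairs -mulr_suml.
  (* Only the digit [b0] is kept from the nonnegative double sum; for it the differences reduce to
     [(t - t0) / m]. *)
  have : w * (size T)%:R <= \sum_(j <- J) psi r (fun i => u j i - q i).
    rewrite /J big_allpairs (big_rem b0) //= -[leLHS]addr0; apply: lerD; last first.
      by apply: sumr_ge0 => b _; apply: sumr_ge0 => t _; exact: psi_ge0.
    rewrite mulrC (le_trans Ht0) // le_eqVlt; apply/orP; left; apply/eqP.
    apply: eq_bigr => t _; congr psi; apply/funext => i.
    by rewrite /wT /q /u /=; ring.
  have : 2 * del * ((size B)%:R * (size T)%:R) <= w * (size T)%:R / 2.
    rewrite [leRHS]mulrAC mulrA ler_wpM2r //.
    rewrite /del (_ : _ * _ = (w / 2) * ((size B)%:R / C.+1%:R)); last first.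
      by move: C0; move: (C.+1%:R : R) => K K0; field.
    by rewrite ler_piMr ?divr_ge0 ?(ltW w0) // ler_pdivrMr ?ltr0n // mul1r ler_nat ltnW.
  rewrite -[del *+ _]mulr_natr natrM.
  move: (\sum_(j <- J) _) (w * _) ((size B)%:R * _) => S W N; lra.
by exists f; rewrite -exprMn; move: Hf; rewrite /J big_allpairs.
Qed.

End Equipositivity.

(** * Parseval for the finite convolutions *)

Section Levels.
Variables (R : realType) (d : nat).
Implicit Types (l : 'rV[int]_d) (x y u v : 'rV[R]_d).

Definition toR l : 'rV[R]_d := map_mx intr l.

Lemma toRD l l' : toR (l + l') = toR l + toR l'.
Proof. by apply/rowP => i; rewrite !mxE intrD. Qed.

Lemma toR_inj : injective toR.
Proof. by move=> l l' /rowP E; apply/rowP => i; have := E i; rewrite !mxE => /intr_inj. Qed.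

Lemma dotvDl u v x : dotv (u + v) x = dotv u x + dotv v x.
Proof. by rewrite /dotv -big_split; apply: eq_bigr => i _; rewrite !mxE mulrDl. Qed.

Lemma dotvDr u x y : dotv u (x + y) = dotv u x + dotv u y.
Proof. by rewrite /dotv -big_split; apply: eq_bigr => i _; rewrite !mxE mulrDr. Qed.

Lemma dotv0r u : dotv u 0 = 0.
Proof. by rewrite /dotv big1 // => i _; rewrite mxE mulr0. Qed.

Lemma dotv0l x : dotv 0 x = 0.
Proof. by rewrite /dotv big1 // => i _; rewrite mxE mul0r. Qed.

Lemma dotvBl u v x : dotv (u - v) x = dotv u x - dotv v x.
Proof. by rewrite /dotv -sumrB; apply: eq_bigr => i _; rewrite !mxE mulrBl. Qed.

Variables (m : nat -> 'I_d -> nat) (Bs : nat -> seq 'rV[int]_d).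
Hypothesis HD : forall n, in_Dd (m n) (Bs n).

Local Notation X n := (conv_points R m Bs n).
Local Notation dig := (scaled_digit R m).

Definition Pn n (i : 'I_d) : nat := \prod_(j < n) m j i.

Lemma PnS n i : Pn n.+1 i = (Pn n i * m n i)%N.
Proof. by rewrite /Pn big_ord_recr. Qed.

Lemma m_ge2 n i : (2 <= m n i)%N.
Proof. by case: (HD n) => + _; apply. Qed.

Lemma size_B_gt0 n : (0 < size (Bs n))%N.
Proof. by case: (HD n) => _ [_ [+ _]]. Qed.

Lemma digit_range n b i : b \in Bs n -> 0 <= b 0 i < (m n i)%:Z.
Proof. by case: (HD n) => _ [_ [_ H]] /H /(_ i) [-> ->]. Qed.

Lemma m_gt0 n i : 0 < (m n i)%:R :> R.
Proof. by rewrite ltr0n (leq_trans _ (m_ge2 n i)). Qed.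

Lemma Pn_ge n i : (2 ^ n <= Pn n i)%N.
Proof.
elim: n => [|n IHn]; first by rewrite /Pn big_ord0.
by rewrite PnS expnSr leq_mul // m_ge2.
Qed.

Lemma Pn_gt0 n i : 0 < (Pn n i)%:R :> R.
Proof. by rewrite ltr0n (leq_trans _ (Pn_ge n i)) // expn_gt0. Qed.

Lemma PnRS n i : (Pn n.+1 i)%:R = (Pn n i)%:R * (m n i)%:R :> R.
Proof. by rewrite PnS natrM. Qed.

Definition Pmul n l : 'rV[int]_d := \row_i ((Pn n i)%:Z * l 0 i).

Lemma conv_points_lattice n x i : x \in X n ->
  exists k : int, (Pn n i)%:R * x 0 i = k%:~R.
Proof.
elim: n x => [|n IHn] x /=.
  by rewrite inE => /eqP ->; exists 0; rewrite mxE mulr0.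
move=> /allpairsP [[x' b] /= [/IHn [k Hk] bB ->]].
exists (k * (m n i)%:Z + b 0 i).
rewrite !mxE -/(Pn n.+1 i) mulrDr mulrCA mulfV ?gt_eqF ?Pn_gt0 // mulr1.
by rewrite PnRS mulrAC Hk intrD intrM -pmulrn.
Qed.

(** The atoms lie in [P_n^{-1} Z^d], so [P_n k] pairs integrally with them. Moving a frequency by
    [P_n Z^d] is thus invisible at level [n], whereas it can change the tail transform. *)
Lemma char_period n l k x : x \in X n ->
  e1 (- dotv (toR (l + Pmul n k)) x) = e1 (- dotv (toR l) x).
Proof.
move=> xX; rewrite toRD dotvDl opprD e1D.
suff -> : e1 (- dotv (toR (Pmul n k)) x) = 1 by rewrite mulr1.
rewrite /dotv -sumrN e1_sum big1 // => i _.
have [z Hz] := conv_points_lattice i xX.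
rewrite !mxE intrM -pmulrn mulrAC Hz -intrM -intrN; exact: e1_int.
Qed.

Lemma dotv_Pmul_digit n b l : dotv (toR (Pmul n l)) (dig n b) = Rinv_dot R (m n) b l.
Proof.
apply: eq_bigr => i _; rewrite !mxE -/(Pn n.+1 i) PnRS intrM -pmulrn.
have := m_gt0 n i; have := Pn_gt0 n i.
by move=> /gt_eqF/negbT ? /gt_eqF/negbT ?; field; apply/andP.
Qed.

(** Atoms are counted with multiplicity and the frequencies form a mere sequence; that they are
    distinct follows from the identity, see [parseval_uniq]. *)
Definition parseval n (S : seq 'rV[int]_d) : Prop := forall g : 'rV[R]_d -> R[i],
  \sum_(l <- S) nsq (\sum_(x <- X n) g x * e1 (- dotv (toR l) x)) =
  (size (X n))%:R * \sum_(x <- X n) nsq (g x).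

Lemma parseval0 : parseval 0 [:: 0].
Proof.
move=> g; rewrite /= !big_seq1 dotv0r oppr0 e1_0 mulr1.
by rewrite mul1r.
Qed.

(** The new frequencies are [l + P_n k] with [k] in the set [L] of the level; [k = 0] keeps the old
    ones. Since [P_n k] acts on the digit alone, Parseval is applied in [k] over the digits, then in
    [l] over [X_n]. *)
Lemma parseval_step n S : admissible R (m n) (Bs n) -> parseval n S ->
  exists S', parseval n.+1 S' /\ {subset S <= S'}.
Proof.
move=> /(admissible_parseval0 (size_B_gt0 n)) [L [HL L0]] HS.
exists [seq l + Pmul n k | l <- S, k <- L]; split; last first.
  move=> l lS; apply/allpairsP; exists (l, 0); split => //=.
  by apply/rowP => i; rewrite !mxE mulr0 addr0.
move=> g; rewrite /= size_allpairs !big_allpairs_dep /=.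
pose h l b := e1 (- dotv (toR l) (dig n b)) *
  \sum_(x <- X n) g (x + dig n b) * e1 (- dotv (toR l) x).
have E l : \sum_(k <- L) nsq (\sum_(z <- [seq x + dig n b | x <- X n, b <- Bs n])
      g z * e1 (- dotv (toR (l + Pmul n k)) z)) =
    (size (Bs n))%:R * \sum_(b <- Bs n) nsq (h l b).
  rewrite -HL; apply: eq_bigr => k _; congr nsq.
  rewrite big_allpairs_dep exchange_big /=; apply: eq_bigr => b _.
  rewrite /h mulrAC mulr_sumr big_seq [in RHS]big_seq; apply: eq_bigr => x xX.
  rewrite dotvDr opprD e1D char_period // toRD dotvDl dotv_Pmul_digit opprD e1D.
  by ring.
under eq_bigr do rewrite E.
rewrite -mulr_sumr exchange_big /= natrM -mulrA mulrCA; congr (_ * _).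
rewrite [in RHS]exchange_big mulr_sumr /=; apply: eq_bigr => b _.
rewrite -HS; apply: eq_bigr => l _; exact: nsq_eM.
Qed.

Lemma parseval_extend n n' S : (forall k, admissible R (m k) (Bs k)) ->
  (n <= n')%N -> parseval n S -> exists S', parseval n' S' /\ {subset S <= S'}.
Proof.
move=> Hadm /subnKC <-; move: (n' - n)%N => k HS.
elim: k => [|k [S' [HS' SS']]]; first by exists S; rewrite addn0; split.
have [S2 [H2 S2S]] := parseval_step (Hadm _) HS'.
by exists S2; rewrite addnS; split=> // l /SS' /S2S.
Qed.

Lemma parseval_shift n S (f : 'rV[int]_d -> 'rV[int]_d) : parseval n S ->
  parseval n [seq l + Pmul n (f l) | l <- S].
Proof.
move=> HS g; rewrite -HS big_map; apply: eq_bigr => l _; congr nsq.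
by rewrite big_seq [in RHS]big_seq; apply: eq_bigr => x xX; rewrite char_period.
Qed.

Lemma size_X_gt0 n : (0 < size (X n))%N.
Proof. by elim: n => //= n IHn; rewrite size_allpairs muln_gt0 IHn size_B_gt0. Qed.

(** When Parseval is tested on the character of [l'], the term [l'] alone equals the total [N ^ 2],
    with [N] the size of [X_n]; the other terms must vanish. *)
Lemma parseval_orth n S l l' : parseval n S -> l \in S -> l' \in S -> l != l' ->
  \sum_(x <- X n) e1 (dotv (toR l' - toR l) x) = 0.
Proof.
move=> HS lS l'S ll'.
pose G k : R := nsq (\sum_(x <- X n) e1 (dotv (toR l') x) * e1 (- dotv (toR k) x)).
have GE k : G k = nsq (\sum_(x <- X n) e1 (dotv (toR l' - toR k) x)).
  by congr nsq; apply: eq_bigr => x _; rewrite -e1D dotvBl.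
have N1 : \sum_(x <- X n) nsq (e1 (dotv (toR l') x)) = (size (X n))%:R.
  rewrite (eq_bigr (fun=> 1)) => [|x _]; last exact: nsq_e1.
  exact: sum_const_seq.
have := HS (fun x => e1 (dotv (toR l') x)).
rewrite N1 (eq_bigr G) // -expr2 (big_rem l') //=.
have -> : G l' = (size (X n))%:R ^+ 2.
  rewrite GE (eq_bigr (fun=> 1)); first by rewrite sum_const_seq nsq_nat.
  by move=> x _; rewrite subrr dotv0l e1_0.
have lr : l \in rem l' S by rewrite rem_mem // eq_sym.
rewrite (big_rem l) //= => H; apply: nsq_eq0; rewrite -GE; apply/eqP.
rewrite eq_le nsq_ge0 andbT.
have : 0 <= \sum_(k <- rem l (rem l' S)) G k by apply: sumr_ge0 => *; exact: nsq_ge0.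
by move: H; move: (\sum_(k <- _) _) (G l) (_ ^+ 2) => s g c; lra.
Qed.

(** * Tails and their Fourier transforms *)

Fixpoint tail_points n k : seq 'rV[R]_d :=
  if k is k'.+1 then [seq y + dig (n + k') b | y <- tail_points n k', b <- Bs (n + k')]
  else [:: 0].
Local Notation T := tail_points.

Lemma size_T_gt0 n k : (0 < size (T n k))%N.
Proof. by elim: k => //= k IHk; rewrite size_allpairs muln_gt0 IHk size_B_gt0. Qed.

(** Tail atoms are not rescaled by [P_n], so that level [n + k] is a plain sumset, with
    multiplicity. *)
Lemma sum_X_split (V : nmodType) n k (F : 'rV[R]_d -> V) :
  \sum_(z <- X (n + k)) F z = \sum_(x <- X n) \sum_(y <- T n k) F (x + y).
Proof.
elim: k F => [|k IHk] F /=.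
  by rewrite addn0; apply: eq_bigr => x _; rewrite big_seq1 addr0.
rewrite addnS /= big_allpairs_dep IHk; apply: eq_bigr => x _.
by rewrite big_allpairs_dep; do 2 (apply: eq_bigr => ? _); rewrite addrA.
Qed.

Lemma size_X_split n k : size (X (n + k)) = (size (X n) * size (T n k))%N.
Proof.
elim: k => [|k IHk]; first by rewrite addn0 muln1.
by rewrite addnS /= !size_allpairs IHk mulnA.
Qed.

Lemma sum_T_first (V : nmodType) n k (F : 'rV[R]_d -> V) :
  \sum_(z <- T n k.+1) F z = \sum_(b <- Bs n) \sum_(y <- T n.+1 k) F (dig n b + y).
Proof.
elim: k F => [|k IHk] F.
  rewrite /= addn0 cats0 big_map; apply: eq_bigr => b _.
  by rewrite big_seq1 add0r addr0.
rewrite [T n k.+2]/= big_allpairs_dep IHk; apply: eq_bigr => b _ /=.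
by rewrite big_allpairs_dep addSnnS; do 2 (apply: eq_bigr => ? _); rewrite addrA.
Qed.

Lemma size_T_first n k : size (T n k.+1) = (size (Bs n) * size (T n.+1 k))%N.
Proof.
elim: k => [|k IHk]; first by rewrite /= addn0 muln1 cats0 size_map.
by rewrite [T n k.+2]/= size_allpairs IHk /= size_allpairs addSnnS mulnA.
Qed.

(** The sum telescopes: the largest digit contributes [(m - 1) / P_{n+k+1} = 1 / P_{n+k} - 1 /
    P_{n+k+1}]. *)
Lemma tail_bound n k y i : y \in T n k ->
  0 <= y 0 i <= (Pn n i)%:R^-1 - (Pn (n + k) i)%:R^-1.
Proof.
elim: k y => [|k IHk] y /=.
  by rewrite inE => /eqP->; rewrite mxE addn0 subrr lexx.
move=> /allpairsP [[y' b] /= [/IHk /andP[y0 y1] /(digit_range i) /andP[b0 b1] ->]].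
rewrite !mxE -/(Pn (n + k).+1 i) addnS.
have p0 := Pn_gt0 (n + k) i; have p1 := Pn_gt0 (n + k).+1 i; have m0 := m_gt0 (n + k) i.
have b0' : 0 <= (b 0 i)%:~R :> R by rewrite -[0]/(0%:~R) ler_int.
have b1' : (b 0 i)%:~R <= (m (n + k) i)%:R - 1 :> R.
  by rewrite lerBrDr -[1]/(1%:~R) -intrD pmulrn ler_int -ltzD1 ltrD2r.
rewrite addr_ge0 //=; last by rewrite divr_ge0 // ltW.
have E : (Pn (n + k) i)%:R^-1 = (m (n + k) i)%:R / (Pn (n + k).+1 i)%:R :> R.
  by rewrite PnRS; move: p0 m0 => /gt_eqF/negbT ? /gt_eqF/negbT ?; field; apply/andP.
apply: le_trans (lerD y1 (ler_wpM2r _ b1')) _; first by rewrite invr_ge0 ltW.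
by rewrite E mulrBl mul1r; lra.
Qed.

Lemma tail_le n k y i : y \in T n k -> 0 <= y 0 i <= (Pn n i)%:R^-1.
Proof.
move=> /(tail_bound i) /andP[-> /le_trans]; apply.
by rewrite gerBl invr_ge0.
Qed.

Definition tlsum n k l : R[i] := \sum_(y <- T n k) e1 (- dotv (toR l) y).

(** Squared modulus of the Fourier transform, at [l], of the uniform measure on the tail atoms. *)
Definition tln n k l : R := nsq (tlsum n k l) / (size (T n k))%:R ^+ 2.

Lemma tlsumS n k l :
  tlsum n k.+1 l = tlsum n k l * \sum_(b <- Bs (n + k)) e1 (- dotv (toR l) (dig (n + k) b)).
Proof.
rewrite /tlsum /= big_allpairs_dep big_distrlr /=.
by do 2 (apply: eq_bigr => ? _); rewrite dotvDr opprD e1D.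
Qed.

(** A further level multiplies the transform by that of a probability measure, of modulus at most
    1. *)
Lemma tlnS_le n k l : tln n k.+1 l <= tln n k l.
Proof.
rewrite /tln tlsumS nsqM /= size_allpairs natrM exprMn invfM.
set A := nsq (tlsum _ _ _); set a := (size (T n k))%:R ^- 2.
set c := nsq _; set e := (size _)%:R ^- 2.
suff ce : c * e <= 1.
  rewrite mulrACA ler_piMr // mulr_ge0 ?nsq_ge0 // invr_ge0 sqr_ge0 //.
rewrite ler_pdivrMr ?mul1r ?exprn_gt0 ?ltr0n ?size_B_gt0 //.
apply: le_trans (nsq_sum_le _ _) _.
rewrite (eq_bigr (fun=> 1)) => [|b _]; last exact: nsq_e1.
by rewrite sum_const_seq expr2.
Qed.

Lemma tln_mono n k k' l : (k <= k')%N -> tln n k' l <= tln n k l.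
Proof.
move=> /subnKC <-; elim: (k' - k)%N => [|j IHj]; first by rewrite addn0.
by rewrite addnS (le_trans (tlnS_le _ _ _)).
Qed.

(** For fixed [l] the tail shrinks like [2 ^ (-n)], so all phases end up within [th] and the
    averaged real part is at least 1/2, uniformly in [k]. This keeps frequencies chosen earlier good
    at later levels. *)
Lemma tln_small l : exists N : nat, forall n k, (N <= n)%N -> 4^-1 <= tln n k l.
Proof.
have [th th0 Hth] := cos_ge_half R.
pose A : R := 2 * pi * \sum_i `|(l 0 i)%:~R|.
have A0 : 0 <= A.
  by rewrite !mulr_ge0 ?pi_ge0 // sumr_ge0.
have [N HN] : exists N : nat, A / th < 2 ^+ N.
  exists (Num.bound (A / th)); apply: lt_le_trans (archi_boundP _) _.
    by rewrite divr_ge0 // ltW.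
  by rewrite -natrX ler_nat ltnW // ltn_expl.
exists N => n k Nn.
suff H : (size (T n k))%:R / 2 <= complex.Re (tlsum n k l).
  rewrite /tln ler_pdivlMr ?exprn_gt0 ?ltr0n ?size_T_gt0 //.
  apply: le_trans (Re_sqr_le _).
  rewrite (_ : 4^-1 * _ = ((size (T n k))%:R / 2) ^+ 2); last by field.
  by apply: lerXn2r => //; rewrite nnegrE ?divr_ge0 // (le_trans _ H) // divr_ge0.
rewrite /tlsum Re_sum mulr_natl -sum_const_seq big_seq [leRHS]big_seq.
apply: ler_sum => y yT; rewrite /e1 /=; apply: Hth.
rewrite mulrN normrN normrM ger0_norm ?mulr_ge0 ?pi_ge0 //.
move: HN; rewrite ltr_pdivrMr // => /ltW HN.
rewrite -(ler_pM2l (x := 2 ^+ N)) ?exprn_gt0 //; apply: le_trans HN.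
rewrite /A mulrCA ler_pM2l ?mulr_gt0 ?pi_gt0 //.
rewrite -[Y in Y * _]ger0_norm ?exprn_ge0 // -normrM /dotv mulr_sumr.
apply: le_trans (ler_norm_sum _ _ _) _; apply: ler_sum => i _.
rewrite !mxE mulrCA normrM ler_piMr //.
have /andP[y0 y1] := tail_le i yT.
rewrite ger0_norm ?mulr_ge0 ?exprn_ge0 //.
apply: le_trans (ler_wpM2l _ y1) _; rewrite ?exprn_ge0 //.
rewrite ler_pdivrMr ?Pn_gt0 // mul1r -natrX ler_nat.
by rewrite (leq_trans _ (Pn_ge n i)) // leq_exp2l.
Qed.

(** Rescaling by [P_{n+1}] puts the tail after level [n] in the unit cube, and the integer part of
    [P_n^{-1} l] is absorbed in the translation; this is the setting of [equipositivity]. *)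
Lemma tail_equipositive (m0 : 'I_d -> nat) (C : nat) : (forall i, (d.+1 <= m0 i)%N) ->
  exists2 eps : R, 0 < eps & forall n l, (forall i, m n i = m0 i) ->
    (size (Bs n) <= C)%N -> exists k, forall K, eps <= tln n K (l + Pmul n k).
Proof.
move=> dm; have [eps eps0 [r Hr]] := equipositivity R C dm.
exists eps => // n l mE BC.
pose fl i : int := Num.floor ((l 0 i)%:~R / (Pn n i)%:R : R).
pose x i : R := (l 0 i)%:~R / (Pn n i)%:R - (fl i)%:~R.
have x1 i : 0 <= x i <= 1.
  have /andP[h1 h2] := floor_itv ((l 0 i)%:~R / (Pn n i)%:R : R).
  by move: h1 h2; rewrite /x -/(fl i) intrD; lra.
pose kf (f : {ffun 'I_d -> 'I_(r.*2.+1)}) : 'rV[int]_d := \row_i (freq f i - fl i).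
have HK K : exists f, eps <= tln n K.+1 (l + Pmul n (kf f)).
  pose T' : seq 'rV[R]_d := [seq \row_i ((Pn n.+1 i)%:R * y 0 i) | y <- T n.+1 K].
  have [|b bB i|||//|f Hf] := Hr (Bs n) T' x.
  - by rewrite size_B_gt0.
  - by rewrite -mE; exact: digit_range.
  - by rewrite size_map size_T_gt0.
  - move=> t /mapP [y yT ->] i; rewrite mxE.
    have /andP[y0 y1] := tail_le i yT; have p0 := Pn_gt0 n.+1 i.
    rewrite mulr_ge0 //=.
    by rewrite -[leRHS](mulfV (lt0r_neq0 p0)) ler_pM2l.
  exists f; rewrite /tln ler_pdivlMr ?exprn_gt0 ?ltr0n ?size_T_gt0 //.
  rewrite size_T_first natrM; move: Hf; rewrite size_map => /le_trans; apply.
  rewrite le_eqVlt; apply/orP; left; apply/eqP; congr nsq.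
  rewrite /tlsum sum_T_first; apply: eq_bigr => b _; rewrite big_map.
  apply: eq_bigr => y _; congr (e1 (- _)); apply: eq_bigr => i _.
  rewrite !mxE -/(Pn n.+1 i) -mE /x; move: (freq f i) (fl i) => fr w.
  rewrite intrD intrM intrB -pmulrn PnRS.
  have := m_gt0 n i; have := Pn_gt0 n i.
  by move=> /gt_eqF/negbT ? /gt_eqF/negbT ?; field; apply/andP.
(* The index [f] found so far depends on [K]. If each of the finitely many [f] failed at some [K],
   all would fail at the largest of these, since [tln] is nonincreasing in [K]. *)
apply: contrapT => /forallNP H.
have {}H (f : {ffun 'I_d -> 'I_(r.*2.+1)}) : exists K, tln n K (l + Pmul n (kf f)) < eps.
  have /existsNP [K /negP] := H (kf f); rewrite -ltNge => ?; by exists K.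
have {H} [Kf HKf] := fin_all_exists H.
have [f Hf] := HK (\max_f Kf f).
have := HKf f; rewrite ltNge => /negP; apply.
by apply: le_trans Hf (tln_mono _ _ _); rewrite ltnW // ltnS leq_bigmax.
Qed.

(** * Construction of the nested frequency sets *)

Hypothesis Hadm : forall n, admissible R (m n) (Bs n).
Hypothesis Hrep : exists (m0 : 'I_d -> nat) (B0 : seq 'rV[int]_d),
  (forall i, (d.+1 <= m0 i)%N) /\
  (forall N : nat, exists n : nat, (N <= n)%N /\
     (forall i, m n i = m0 i) /\ Bs n =i B0).

(** From one chosen level to the next, old frequencies stay in place, their tail transform being at
    least 1/4 by [tln_small] once the level is large; new ones are moved by [tail_equipositive] at
    an occurrence of the repeated pair. *)
Lemma nested_spectra : exists2 eps : R, 0 < eps &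
  exists (ns : nat -> nat) (S : nat -> seq 'rV[int]_d),
  forall j, [/\ (j <= ns j)%N, parseval (ns j) (S j), {subset S j <= S j.+1} &
    forall l, l \in S j -> forall k, eps <= tln (ns j) k l].
Proof.
have [m0 [B0 [dm rep]]] := Hrep.
have [eps' eps'0 Heps] := tail_equipositive (size B0) dm.
pose eps := Num.min eps' 4^-1.
have epsE : eps <= eps' by rewrite ge_min lexx.
have eps4 : eps <= 4^-1 by rewrite ge_min lexx orbT.
exists eps; first by rewrite lt_min eps'0 invr_gt0 ltr0n.
pose good (p : nat * seq 'rV[int]_d) := parseval p.1 p.2.
pose next (p q : nat * seq 'rV[int]_d) := [/\ (p.1 < q.1)%N, {subset p.2 <= q.2}
  & forall l, l \in q.2 -> forall k, eps <= tln q.1 k l].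
have step p : good p -> exists q, good q /\ next p q.
  case: p => n S; rewrite /good /= => HS.
  have [N HN] : exists N : nat, forall n' k l, (N <= n')%N -> l \in S -> 4^-1 <= tln n' k l.
    have [N HN] := choice tln_small.
    exists (\max_(l <- S) N l) => n' k l Nn lS; apply: HN.
    by apply: leq_trans Nn; rewrite (big_rem l) //= leq_maxl.
  have [n' [nn' [mE BE]]] := rep (maxn n.+1 N).
  have [S1 [H1 SS1]] : exists S', parseval n' S' /\ {subset S <= S'}.
    by apply: parseval_extend HS => //; exact: ltnW (leq_trans (leq_maxl _ _) nn').
  (* [Bs n'] and [B0] agree as sets; being duplicate-free, [Bs n'] is no longer than [B0]. *)
  have BC : (size (Bs n') <= size B0)%N.
    by apply: uniq_leq_size; [case: (HD n') => _ [] | move=> b; rewrite BE].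
  have [kk Hkk] := choice (fun l => Heps n' l mE BC).
  exists (n', [seq l + Pmul n' (if l \in S then 0 else kk l) | l <- S1]).
  split; first exact: (parseval_shift (fun l => if l \in S then 0 else kk l)).
  have P0 l : l + Pmul n' 0 = l.
    by apply/rowP => i; rewrite !mxE mulr0 addr0.
  split => /=.
  - exact: leq_trans (leq_maxl _ _) nn'.
  - by move=> l lS; apply/mapP; exists l; [exact: SS1 | rewrite lS P0].
  - move=> _ /mapP [l lS1 ->] k; case: ifPn => [lS|_].
      rewrite P0 (le_trans eps4) // HN //.
      exact: leq_trans (leq_maxr _ _) nn'.
    by rewrite (le_trans epsE) // Hkk.
(* Made total, with a dummy value off [good], so that choice yields a function to iterate. *)
have step' p : exists q, good p -> good q /\ next p q.
  by case: (pselect (good p)) => [/step [q Hq]|np]; [exists q | exists p].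
have [nx Hnx] := choice step'.
(* One iteration is already applied at [j = 0]: the lower bound on [tln] is a property of the
   outcome of a step, not of the starting set. *)
pose sq j := iter j.+1 nx (0%N, [:: 0]).
have gsq j : good (sq j).
  elim: j => [|j IHj]; rewrite /sq iterS.
    by apply: (Hnx _ _).1; exact: parseval0.
  exact: (Hnx _ IHj).1.
exists (fun j => (sq j).1), (fun j => (sq j).2) => j; split.
- elim: j => // j IHj; apply: leq_ltn_trans IHj _.
  by case: (Hnx _ (gsq j)).2.
- exact: gsq.
- by case: (Hnx _ (gsq j)).2.
- case: j => [|j]; last by case: (Hnx _ (gsq j)).2.
  by case: (Hnx (0%N, [:: 0]) parseval0).2.
Qed.

End Levels.

(** * Density of bounded Lipschitz functions in [L^2(mu)] *)

Section Density.
Variables (R : realType) (d : nat).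

(** Bounded continuity makes weak convergence applicable; the Lipschitz bound makes the oscillation
    over a tail quantitative in [oscillation_tail]. *)
Definition bounded_lipschitz (g : 'rV[R]_d -> R) : Prop :=
  (exists K, forall x y, `|g x - g y| <= K * `|x - y|) /\
  (exists M, forall x, `|g x| <= M).

Lemma lipschitz_continuous (g : 'rV[R]_d -> R) :
  (exists K, forall x y, `|g x - g y| <= K * `|x - y|) -> continuous g.
Proof.
move=> [K HK] x; apply/(@cvgrPdist_lt _ _ _ (nbhs x)) => e e0.
have K0 : 0 < `|K| + 1 by rewrite ltr_wpDl.
apply/nbhs_ballP; exists (e / (`|K| + 1)); first by rewrite /= divr_gt0.
move=> y; rewrite -ball_normE /= ltr_pdivlMr // => xy.
apply: le_lt_trans (HK x y) _; apply: le_lt_trans xy.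
by rewrite mulrC ler_wpM2l // (le_trans (ler_norm _)) // lerDl.
Qed.

Lemma continuous_measurable_Rd (g : 'rV[R]_d -> R) : continuous g ->
  measurable_fun setT (g : Rd R d -> R).
Proof.
move=> /continuousP cg; apply: (measurability (RGenOInfty.G (R := R))).
  exact: RGenOInfty.measurableE.
move=> _ [_ [a ->] <-]; rewrite setTI; apply: sub_sigma_algebra.
exact/cg/interval_open.
Qed.

Lemma BL_measurable (g : 'rV[R]_d -> R) : bounded_lipschitz g ->
  measurable_fun setT (g : Rd R d -> R).
Proof. by move=> [/lipschitz_continuous/continuous_measurable_Rd]. Qed.

Lemma BL_cst (c : R) : bounded_lipschitz (fun=> c).
Proof.
by split; [exists 0 => x y; rewrite subrr normr0 mul0r | exists `|c|].
Qed.

Lemma BL_add g h : bounded_lipschitz g -> bounded_lipschitz h ->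
  bounded_lipschitz (fun x => g x + h x).
Proof.
move=> [[K HK] [M HM]] [[L HL] [N HN]]; split.
  exists (K + L) => x y; rewrite opprD addrACA mulrDl.
  by apply: le_trans (ler_normD _ _) _; apply: lerD.
by exists (M + N) => x; apply: le_trans (ler_normD _ _) _; apply: lerD.
Qed.

Lemma BL_scale c g : bounded_lipschitz g -> bounded_lipschitz (fun x => c * g x).
Proof.
move=> [[K HK] [M HM]]; split.
  exists (`|c| * K) => x y; rewrite -mulrBr normrM -mulrA.
  by rewrite ler_wpM2l.
by exists (`|c| * M) => x; rewrite normrM ler_wpM2l.
Qed.

Variable mu : probability (Rd R d) R.
Implicit Types f g h : Rd R d -> R.

(** Squared [L^2] distance, extended-valued so that it makes sense before any integrability is
    known. *)
Definition dist2 f g : \bar R := (\int[mu]_x ((f x - g x) ^+ 2)%:E)%E.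

Definition approximable f : Prop := measurable_fun setT f /\
  forall eta : R, 0 < eta -> exists2 g : 'rV[R]_d -> R,
    bounded_lipschitz g & (dist2 f g < eta%:E)%E.

Lemma measurable_dist2 f g : measurable_fun setT f -> measurable_fun setT g ->
  measurable_fun setT (EFin \o (fun x => (f x - g x) ^+ 2)).
Proof.
move=> mf mg; apply/measurable_EFinP; apply: measurable_funX.
exact: measurable_funB.
Qed.

Lemma dist2_triangle f g h : measurable_fun setT f -> measurable_fun setT g ->
  measurable_fun setT h -> (dist2 f h <= 2%:E * dist2 f g + 2%:E * dist2 g h)%E.
Proof.
move=> mf mg mh; have m1 := measurable_dist2 mf mg; have m2 := measurable_dist2 mg mh.
rewrite /dist2 -!ge0_integralZl_EFin //; last 2 first.
  by move=> x _; rewrite lee_fin sqr_ge0.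
  by move=> x _; rewrite lee_fin sqr_ge0.
rewrite -ge0_integralD //; first last.
  exact: measurable_funeM.
  by move=> x _; rewrite mule_ge0 // lee_fin sqr_ge0.
  exact: measurable_funeM.
  by move=> x _; rewrite mule_ge0 // lee_fin sqr_ge0.
apply: ge0_le_integral => //.
- by move=> x _; rewrite lee_fin sqr_ge0.
- exact: measurable_dist2.
- by apply: emeasurable_funD; exact: measurable_funeM.
- move=> x _; rewrite -!EFinM -EFinD lee_fin.
  have := sqr_ge0 (f x - g x - (g x - h x)); nra.
Qed.

Lemma approximable_BL g : bounded_lipschitz g -> approximable g.
Proof.
move=> Hg; split; first exact: BL_measurable.
move=> eta eta0; exists g => //; rewrite /dist2 integral0_eq ?lte_fin // => x _.
by rewrite subrr expr0n.
Qed.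

Lemma approximable_limit f : measurable_fun setT f ->
  (forall eta : R, 0 < eta -> exists2 h, approximable h & (dist2 f h < eta%:E)%E) ->
  approximable f.
Proof.
move=> mf H; split => // eta eta0.
have eta4 : 0 < eta / 4 by rewrite divr_gt0.
have [h [mh Hh] fh] := H _ eta4; have [g Hg hg] := Hh _ eta4.
exists g => //; apply: le_lt_trans (dist2_triangle mf mh (BL_measurable Hg)) _.
have -> : eta%:E = (2%:E * (eta / 4)%:E + 2%:E * (eta / 4)%:E)%E.
  by rewrite -!EFinM -EFinD; congr EFin; field.
by apply: lteD; rewrite lte_pmul2l.
Qed.

Lemma approximable_add f h : approximable f -> approximable h ->
  approximable (fun x => f x + h x).
Proof.
move=> [mf Hf] [mh Hh]; split; first exact: measurable_funD.
move=> eta eta0; have eta4 : 0 < eta / 4 by rewrite divr_gt0.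
have [g Hg fg] := Hf _ eta4; have [k Hk hk] := Hh _ eta4.
exists (fun x => g x + k x); first exact: BL_add.
have mg := BL_measurable Hg; have mk := BL_measurable Hk.
have mfk : measurable_fun setT (fun x : Rd R d => g x + h x) by exact: measurable_funD.
apply: le_lt_trans (dist2_triangle (measurable_funD mf mh) mfk
  (measurable_funD mg mk)) _.
have -> : dist2 (fun x => f x + h x) (fun x => g x + h x) = dist2 f g.
  by apply: eq_integral => x _; congr (_%:E); ring.
have -> : dist2 (fun x => g x + h x) (fun x => g x + k x) = dist2 h k.
  by apply: eq_integral => x _; congr (_%:E); ring.
have -> : eta%:E = (2%:E * (eta / 4)%:E + 2%:E * (eta / 4)%:E)%E.
  by rewrite -!EFinM -EFinD; congr EFin; field.
by apply: lteD; rewrite lte_pmul2l.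
Qed.

Lemma approximable_scale c f : approximable f -> approximable (fun x => c * f x).
Proof.
move=> [mf Hf]; split; first exact: measurable_funM.
(* [c ^ 2 + 1] replaces [c ^ 2] so as to divide also when [c = 0]. *)
move=> eta eta0; have c0 : 0 < c ^+ 2 + 1 by rewrite ltr_wpDl ?sqr_ge0.
have [g Hg fg] := Hf (eta / (c ^+ 2 + 1)) (divr_gt0 eta0 c0).
exists (fun x => c * g x); first exact: BL_scale.
have -> : dist2 (fun x => c * f x) (fun x => c * g x) = ((c ^+ 2)%:E * dist2 f g)%E.
  rewrite /dist2 -ge0_integralZl_EFin ?sqr_ge0 //.
  - by apply: eq_integral => x _; rewrite -EFinM; congr EFin; ring.
  - by move=> x _; rewrite lee_fin sqr_ge0.
  - exact: measurable_dist2 mf (BL_measurable Hg).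
have -> : eta%:E = ((c ^+ 2 + 1)%:E * (eta / (c ^+ 2 + 1))%:E)%E.
  by rewrite -EFinM mulrC divfK // gt_eqF.
apply: (@le_lt_trans _ _ ((c ^+ 2 + 1)%:E * dist2 f g)%E).
  apply: lee_wpmul2r; last by rewrite lee_fin lerDl.
  by apply: integral_ge0 => x _; rewrite lee_fin sqr_ge0.
by rewrite lte_pmul2l.
Qed.

(** Dominated convergence applied to [(f - h_n) ^ 2], which tends to 0 below [G]. *)
Lemma approximable_dct f (h_ : nat -> Rd R d -> R) (G : Rd R d -> R) :
  measurable_fun setT f -> (forall n, approximable (h_ n)) ->
  mu.-integrable setT (EFin \o G) ->
  (forall n x, (f x - h_ n x) ^+ 2 <= G x) ->
  (forall x, h_ n x @[n --> \oo] --> f x) -> approximable f.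
Proof.
move=> mf Hh iG dom cv; apply: approximable_limit => // eta eta0.
have mh n : measurable_fun setT (h_ n) by case: (Hh n).
have : (dist2 f (h_ n))%E @[n --> \oo] --> (\int[mu]_x (cst 0%E x))%E.
  apply: (@dominated_cvg _ _ _ mu setT measurableT
    (fun n x => ((f x - h_ n x) ^+ 2)%:E) (cst 0%E) (EFin \o G)) => //.
  - by move=> n; exact: measurable_dist2.
  - move=> x _; apply/fine_cvgP; split; first by near=> n.
    suff : ((f x - h_ n x) ^+ 2) @[n --> \oo] --> (f x - f x) * (f x - f x).
      by rewrite subrr mulr0.
    by apply: cvgM; apply: cvgB => //; exact: cvg_cst.
  - by move=> n x _; rewrite /= lee_fin ger0_norm ?sqr_ge0 // dom.
rewrite integral0 => /fine_cvgP [fin cv0].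
move: cv0 => /cvgrPdist_lt/(_ eta eta0) cv0.
near \oo => n; exists (h_ n) => //.
have fn : dist2 f (h_ n) \is a fin_num by near: n.
rewrite -(fineK fn) lte_fin.
have : `|0 - fine (dist2 f (h_ n))| < eta by near: n.
by rewrite sub0r normrN => /(le_lt_trans (ler_norm _)).
Unshelve. all: by end_near. Qed.

Lemma integrable_cst1 : mu.-integrable setT (EFin \o (fun=> 1 : R) : Rd R d -> \bar R).
Proof. exact: finite_measure_integrable_cst. Qed.

Lemma sqr_indic_le1 (U : set (Rd R d)) (a : R) x : 0 <= a <= 1 -> (\1_U x - a) ^+ 2 <= 1.
Proof. by rewrite indicE; case: (x \in U) => /= /andP[*]; nra. Qed.

Lemma open_measurable_Rd (U : set 'rV[R]_d) : open U -> measurable (U : set (Rd R d)).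
Proof. by move=> oU; exact: sub_sigma_algebra. Qed.

Section Distance.
Variable A : set 'rV[R]_d.
Hypothesis A0 : A !=set0.

Definition dist_to x : R := inf [set `|x - z| | z in A].

Lemma dist_to_le x z : A z -> dist_to x <= `|x - z|.
Proof.
move=> Az; apply: inf_lbound; last by exists z.
by exists 0 => _ [y _ <-].
Qed.

Lemma dist_to_ge x e : (forall z, A z -> e <= `|x - z|) -> e <= dist_to x.
Proof.
move=> H; apply: lb_le_inf; first by have [z Az] := A0; exists `|x - z|, z.
by move=> _ [z Az <-]; exact: H.
Qed.

Lemma dist_to_ge0 x : 0 <= dist_to x.
Proof. exact: dist_to_ge. Qed.

Lemma dist_to_lip x y : `|dist_to x - dist_to y| <= `|x - y|.
Proof.
have H u v : dist_to u - dist_to v <= `|u - v|.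
  rewrite lerBlDr -lerBlDl; apply: dist_to_ge => z Az.
  rewrite lerBlDl (le_trans (dist_to_le u Az)) //.
  by rewrite -[u - z](subrKA v) ler_normD.
by rewrite ler_norml H andbT lerNl opprB distrC H.
Qed.

Lemma BL_dist (k : R) : bounded_lipschitz (fun x => Num.min 1 (`|k| * dist_to x)).
Proof.
split.
  exists `|k| => x y; apply: (@le_trans _ _ (`| `|k| * dist_to x - `|k| * dist_to y|)).
    move: (_ * dist_to x) (_ * dist_to y) => a b.
    rewrite /Num.min; case: ifPn; case: ifPn; rewrite -?leNgt => h1 h2 //.
    - by rewrite subrr normr0.
    - rewrite ler_norml; have := ler_norm (a - b); have := ler_norm (b - a).
      by rewrite distrC; move: h1 h2; lra.
    - rewrite ler_norml; have := ler_norm (a - b); have := ler_norm (b - a).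
      by rewrite distrC; move: h1 h2; lra.
  by rewrite -mulrBr normrM normr_id ler_wpM2l // dist_to_lip.
exists 1 => x; rewrite ger0_norm ?ge_min ?lexx //.
by rewrite le_min ler01 mulr_ge0 // dist_to_ge0.
Qed.

End Distance.

(** The indicator is the pointwise limit of [n] times the distance to the complement, cut off at 1.
    When [U] is the whole space there is no such distance and the indicator is constant. *)
Lemma approximable_open (U : set 'rV[R]_d) : open U ->
  approximable (\1_(U : set (Rd R d)) : Rd R d -> R).
Proof.
move=> oU; have mU := open_measurable_Rd oU.
have [A0|] := pselect (~` U !=set0); last first.
  move=> /nonemptyPn/(congr1 setC); rewrite setCK setC0 => ->.
  rewrite (_ : \1__ = fun=> 1); first exact/approximable_BL/BL_cst.
  by apply/funext => x; rewrite indicE in_setT.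
pose h n x : R := Num.min 1 (`|n%:R| * dist_to (~` U) x).
have h01 n x : 0 <= h n x <= 1.
  by rewrite /h le_min ler01 mulr_ge0 ?dist_to_ge0 //= ge_min lexx.
apply: (@approximable_dct _ h (fun=> 1)).
- exact: measurable_indic.
- by move=> n; exact/approximable_BL/BL_dist.
- exact: integrable_cst1.
- by move=> n x; exact: sqr_indic_le1.
move=> x; have [Ux|nUx] := pselect (U x).
  have [e e0 He] : exists2 e : R, 0 < e & e <= dist_to (~` U) x.
    move: oU; rewrite openE => /(_ x Ux) /nbhs_ballP [e /= e0 He].
    exists e => //; apply: dist_to_ge => // z nUz; rewrite leNgt; apply/negP => xz.
    by apply: nUz; apply: He; rewrite -ball_normE.
  apply: cvg_near_cst; near=> n.
  rewrite indicE mem_set // /h; apply/eqP; rewrite eq_minl //.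
  rewrite normr_nat; apply: (@le_trans _ _ (n%:R * e)); last by rewrite ler_wpM2l.
  rewrite -ler_pdivrMr // mul1r; near: n; exact: nbhs_infty_ger.
apply: cvg_near_cst; near=> n.
rewrite indicE memNset // /h (_ : dist_to _ x = 0) ?mulr0; last first.
  by apply/eqP; rewrite eq_le dist_to_ge0 // andbT (le_trans (dist_to_le (z := x) _ _)) // subrr normr0.
by apply/eqP; rewrite eq_minr.
Unshelve. all: by end_near. Qed.

(** Dynkin's argument: the good sets form a lambda-system containing the open sets, which are stable
    under intersection. *)
Lemma approximable_indic (A : set (Rd R d)) : measurable A ->
  approximable (\1_A : Rd R d -> R).
Proof.
pose H : set (set (Rd R d)) := [set B | measurable B /\ approximable (\1_B : Rd R d -> R)].
suff : (<<s @open 'rV[R]_d >> : set (set (Rd R d))) `<=` H by move=> sub /sub [].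
apply: (@lambda_system_subset _ (@open 'rV[R]_d) _ setT).
- by move=> B C oB oC; exact: openI.
- split => //.
  + split; first exact: measurableT.
    rewrite (_ : \1__ = fun=> 1); first exact/approximable_BL/BL_cst.
    by apply/funext => x; rewrite indicE in_setT.
  + move=> B C CB [mB aB] [mC aC]; split; first exact: measurableD.
    rewrite (_ : \1__ = fun x => \1_B x + (-1) * \1_C x).
      by apply: approximable_add => //; exact: approximable_scale.
    apply/funext => x; rewrite !indicE in_setD.
    have [xC|] := boolP (x \in C); last by rewrite andbT mulr0 addr0.
    by rewrite andbF /= mulr1 (_ : x \in B) ?subrr //; move: xC; rewrite !inE => /CB.
  + move=> F ndF HF; have mF : measurable (\bigcup_i F i : set (Rd R d)).
      by apply: bigcupT_measurable => i; case: (HF i).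
    split => //; apply: (@approximable_dct _ (fun n => \1_(F n : set (Rd R d))) (fun=> 1)).
    * exact: measurable_indic.
    * by move=> n; case: (HF n).
    * exact: integrable_cst1.
    * by move=> n x; apply: sqr_indic_le1; rewrite indicE; case: (_ \in _); rewrite /= ?ler01 ?lexx.
    * move=> x; apply: cvg_near_cst.
      have [[k _ Fkx]|nx] := pselect ((\bigcup_i F i) x).
        near=> n; rewrite !indicE mem_set; last first.
          have /ndF/subsetPset : (k <= n)%N by near: n; exact: nbhs_infty_ge.
          exact.
        by rewrite mem_set //; exists k.
      near=> n; rewrite !indicE memNset; last by move=> Fnx; apply: nx; exists n.
      by rewrite memNset.
- by move=> U oU; split; [exact: open_measurable_Rd | exact: approximable_open].
- by [].
Unshelve. all: by end_near. Qed.

Lemma approximable_sum (I : Type) (s : seq I) (F : I -> Rd R d -> R) :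
  (forall i, approximable (F i)) -> approximable (fun x => \sum_(i <- s) F i x).
Proof.
move=> HF; elim: s => [|i s IHs].
  rewrite (_ : (fun x => _) = fun=> 0); first exact/approximable_BL/BL_cst.
  by apply/funext => x; rewrite big_nil.
rewrite (_ : (fun x => _) = fun x => F i x + \sum_(j <- s) F j x).
  exact: approximable_add.
by apply/funext => x; rewrite big_cons.
Qed.

Import HBNNSimple.

Lemma approximable_nnsfun (h : {nnsfun Rd R d >-> R}) : approximable h.
Proof.
rewrite (_ : (h : Rd R d -> R) = fun x =>
  \sum_(y <- finmap.enum_fset (fset_set (range h))) y * \1_(h @^-1` [set y]) x).
  apply: approximable_sum => y; apply/approximable_scale/approximable_indic.
  exact: measurable_sfunP.
by apply/funext => x; rewrite -fsbig_finite // -fimfunE.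
Qed.

(** Simple functions increasing to [f] stay between [0] and [f], so [f ^ 2] dominates the squared
    error. *)
Lemma approximable_ge0 f : measurable_fun setT f -> (forall x, 0 <= f x) ->
  mu.-integrable setT (EFin \o (fun x => f x ^+ 2)) -> approximable f.
Proof.
move=> mf f0 if2.
have mEf : measurable_fun setT (EFin \o f) by exact/measurable_EFinP.
pose h n : Rd R d -> R := nnsfun_approx measurableT mEf n.
have cv x : h n x @[n --> \oo] --> f x.
  have := @cvg_nnsfun_approx _ _ _ setT measurableT _ mEf
    (fun x _ => f0 x : (0 <= (f x)%:E)%E) x I.
  by move=> /fine_cvgP [_].
have hf n x : 0 <= h n x <= f x.
  rewrite fun_ge0 /=.
  have nd : nondecreasing_seq (fun n => h n x).
    by move=> i j ij; have /lefP := nd_nnsfun_approx measurableT mEf ij; exact.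
  have := nondecreasing_cvgn_le nd (cvgP _ (cv x)) n.
  by rewrite (cvg_lim _ (cv x)).
apply: (approximable_dct mf _ if2 _ cv) => [n|n x].
  exact: approximable_nnsfun.
by have := hf n x; move=> /andP[*]; nra.
Qed.

Lemma approximable_L2 f : measurable_fun setT f ->
  mu.-integrable setT (EFin \o (fun x => f x ^+ 2)) -> approximable f.
Proof.
move=> mf if2.
have pos (g : Rd R d -> R) : measurable_fun setT g ->
    (forall x, 0 <= g x) -> (forall x, g x <= `|f x|) -> approximable g.
  move=> mg g0 gf; apply: approximable_ge0 => //.
  apply: le_integrable if2 => //.
    by apply/measurable_EFinP; exact: measurable_funX.
  move=> x _; rewrite /= lee_fin !ger0_norm ?sqr_ge0 // -(real_normK (num_real (f x))).
  by apply: lerXn2r; rewrite ?nnegrE.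
rewrite (_ : f = fun x => Num.max (f x) 0 + (-1) * Num.max (- f x) 0).
  apply: approximable_add; last apply: approximable_scale; apply: pos.
  - exact: measurable_maxr.
  - by move=> x; rewrite le_max lexx orbT.
  - by move=> x; rewrite ge_max ler_norm normr_ge0.
  - by apply: measurable_maxr => //; exact: measurableT_comp.
  - by move=> x; rewrite le_max lexx orbT.
  - by move=> x; rewrite ge_max -normrN ler_norm normr_ge0.
by apply/funext => x; rewrite /Num.max; case: ifPn; case: ifPn; rewrite -?leNgt; lra.
Qed.

End Density.

(** * The frame inequality at a finite level *)

Section FrameBound.
Variables (R : realType) (d : nat).
Variables (m : nat -> 'I_d -> nat) (Bs : nat -> seq 'rV[int]_d).
Hypothesis HD : forall n, in_Dd (m n) (Bs n).
Local Notation X n := (conv_points R m Bs n).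
Local Notation T := (tail_points R m Bs).

(** A frequency listed twice would contribute [N ^ 2] twice to a total of [N ^ 2] when Parseval is
    tested on its own character. *)
Lemma parseval_uniq n (S : seq 'rV[int]_d) : parseval R m Bs n S -> uniq S.
Proof.
move=> HS; apply: count_mem_uniq => l.
have [lS|] := boolP (l \in S); last by move/count_memPn.
apply/eqP; rewrite eqn_leq -has_count has_pred1 lS andbT leqNgt; apply/negP => c2.
have lr : l \in rem l S.
  by rewrite -has_pred1 has_count count_rem lS /= eqxx subn_gt0.
pose G k : R := nsq (\sum_(x <- X n) e1 (dotv (toR R l) x) * e1 (- dotv (toR R k) x)).
have G0 k : 0 <= G k by exact: nsq_ge0.
have Gl : G l = (size (X n))%:R ^+ 2.
  rewrite /G (eq_bigr (fun=> 1)); first by rewrite sum_const_seq nsq_nat.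
  by move=> x _; rewrite -e1D subrr e1_0.
have N1 : \sum_(x <- X n) nsq (e1 (dotv (toR R l) x)) = (size (X n))%:R.
  rewrite (eq_bigr (fun=> 1)) => [|x _]; last exact: nsq_e1.
  exact: sum_const_seq.
have := HS (fun x => e1 (dotv (toR R l) x)).
rewrite N1 (eq_bigr G) // -expr2 (big_rem l) //= (big_rem l lr) /= Gl.
have : 0 <= \sum_(k <- rem l (rem l S)) G k by apply: sumr_ge0.
have : 0 < (size (X n))%:R ^+ 2 :> R by rewrite exprn_gt0 // ltr0n size_X_gt0.
by move: (\sum_(k <- _) _) (_ ^+ 2) => s c; lra.
Qed.

Definition cavg n (F : 'rV[R]_d -> R[i]) : R[i] :=
  (((size (X n))%:R^-1 : R)%:C)%C * \sum_(x <- X n) F x.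

Lemma Re_cavg n F : complex.Re (cavg n F) = conv_integral m Bs n (fun x => complex.Re (F x)).
Proof. by rewrite /cavg ReZ Re_sum. Qed.

Lemma Im_cavg n F : complex.Im (cavg n F) = conv_integral m Bs n (fun x => complex.Im (F x)).
Proof. by rewrite /cavg ImZ Im_sum. Qed.

(* The [(n + k)]-th convolution is the [n]-th one convolved with the tail; up
   to the oscillation [w] of [g] on tail translates, its Fourier coefficients
   are those of the [n]-th one multiplied by the tail transform. *)
Lemma frame_bound n k (S : seq 'rV[int]_d) (eps w : R) (g : 'rV[R]_d -> R[i]) :
  parseval R m Bs n S -> 0 <= w ->
  (forall l, l \in S -> eps <= tln R m Bs n k l) ->
  (forall x y, x \in X n -> y \in T n k -> nsq (g (x + y) - g x) <= w) ->
  eps * conv_integral m Bs n (fun x => nsq (g x)) <=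
  2 * \sum_(l <- S) nsq (cavg (n + k) (fun x => g x * e1 (- dotv (toR R l) x))) + 2 * w.
Proof.
move=> HS w0 Heps osc.
pose N : R := (size (X n))%:R; pose M : R := (size (T n k))%:R.
have N0 : 0 < N by rewrite ltr0n size_X_gt0.
have M0 : 0 < M by rewrite ltr0n size_T_gt0.
pose A l := \sum_(x <- X n) g x * e1 (- dotv (toR R l) x).
pose b l := tlsum R m Bs n k l.
pose C l := \sum_(x <- X (n + k)) g x * e1 (- dotv (toR R l) x).
(* [A l * b l] is what [C l] would be if [g] were constant along the tail. The error is regrouped by
   tail atom [y], so that Parseval at level [n] applies to each difference [g (x + y) - g x]. *)
have EE l : C l - A l * b l = \sum_(y <- T n k) e1 (- dotv (toR R l) y) *
    \sum_(x <- X n) (g (x + y) - g x) * e1 (- dotv (toR R l) x).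
  transitivity (\sum_(x <- X n) \sum_(y <- T n k) e1 (- dotv (toR R l) y) *
      ((g (x + y) - g x) * e1 (- dotv (toR R l) x))).
    rewrite /C sum_X_split /A /b /tlsum big_distrlr /= -sumrB.
    apply: eq_bigr => x _; rewrite -sumrB; apply: eq_bigr => y _.
    by rewrite dotvDr opprD e1D; ring.
  by rewrite exchange_big /=; apply: eq_bigr => y _; rewrite mulr_sumr.
have HE : \sum_(l <- S) nsq (C l - A l * b l) <= (M * N) ^+ 2 * w.
  apply: (@le_trans _ _ (\sum_(l <- S) M * \sum_(y <- T n k)
      nsq (\sum_(x <- X n) (g (x + y) - g x) * e1 (- dotv (toR R l) x)))).
    apply: ler_sum => l _; rewrite EE; apply: le_trans (nsq_sum_le _ _) _.
    by under eq_bigr do rewrite nsq_eM.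
  rewrite -mulr_sumr exchange_big /= exprMn -mulrA expr2 -mulrA ler_pM2l //.
  have -> : M * (N ^+ 2 * w) = \sum_(y <- T n k) N ^+ 2 * w.
    by rewrite sum_const_seq mulr_natl.
  rewrite big_seq [leRHS]big_seq; apply: ler_sum => y yT.
  rewrite HS expr2 -mulrA ler_pM2l // [leRHS](_ : _ = \sum_(x <- X n) w); last first.
    by rewrite sum_const_seq mulr_natl.
  by rewrite big_seq [leRHS]big_seq; apply: ler_sum => x xX; exact: osc.
(* Parseval for [g] itself, with the lower bound on the tail transform inserted at each
   frequency. *)
have HA : eps * M ^+ 2 * (N * \sum_(x <- X n) nsq (g x)) <= \sum_(l <- S) nsq (A l * b l).
  rewrite -HS mulr_sumr big_seq [leRHS]big_seq; apply: ler_sum => l lS.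
  rewrite nsqM mulrC ler_wpM2l ?nsq_ge0 //.
  by have := Heps l lS; rewrite /tln ler_pdivlMr // exprn_gt0.
have HC : \sum_(l <- S) nsq (A l * b l) <=
    2 * \sum_(l <- S) nsq (C l) + 2 * \sum_(l <- S) nsq (C l - A l * b l).
  by rewrite !mulr_sumr -big_split /=; apply: ler_sum => l _; exact: nsqB_le.
have CE l : nsq (cavg (n + k) (fun x => g x * e1 (- dotv (toR R l) x))) =
    (M * N) ^- 2 * nsq (C l).
  by rewrite /cavg nsqZ size_X_split natrM exprVn mulrC [N * M]mulrC mulrC.
under eq_bigr do rewrite CE.
rewrite -mulr_sumr /conv_integral -/N.
have MN0 : 0 < (M * N) ^+ 2 by rewrite exprn_gt0 // mulr_gt0.
rewrite -(ler_pM2l MN0) mulrDr ![_ * (2 * _)]mulrCA (mulrA (_ ^+ 2) (_ ^- 2)).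
rewrite mulfV ?gt_eqF // mul1r.
have -> : (M * N) ^+ 2 * (eps * (N^-1 * \sum_(x <- X n) nsq (g x))) =
   eps * M ^+ 2 * (N * \sum_(x <- X n) nsq (g x)).
  by field; rewrite gt_eqF.
apply: le_trans HA (le_trans HC _).
by rewrite lerD2l ler_pM2l.
Qed.

(** The norm is the maximum norm, and [P_n >= 2 ^ n >= n + 1]. *)
Lemma tail_norm_le n k y : y \in T n k -> `|y| <= n.+1%:R^-1.
Proof.
move=> yT; rewrite /Num.norm /= mx_normrE; apply: bigmax_le => // -[i j] _ /=.
have /andP[y0 y1] := tail_le HD j yT; rewrite (ord1 i) ger0_norm //.
apply: le_trans y1 _; rewrite lef_pV2 ?posrE ?(Pn_gt0 _ HD) ?ltr0n //.
by rewrite ler_nat (leq_trans _ (Pn_ge HD n j)) // ltn_expl.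
Qed.

End FrameBound.

(** * Complex-valued integrals *)

Section ComplexIntegral.
Variables (R : realType) (d : nat) (mu : probability (Rd R d) R).
Implicit Types (g h : Rd R d -> R[i]).

Definition cintegrable g : Prop :=
  mu.-integrable setT (EFin \o (fun x => complex.Re (g x))) /\
  mu.-integrable setT (EFin \o (fun x => complex.Im (g x))).

Lemma integrableDR (u v : Rd R d -> R) : mu.-integrable setT (EFin \o u) ->
  mu.-integrable setT (EFin \o v) -> mu.-integrable setT (EFin \o (fun x => u x + v x)).
Proof.
move=> iu iv; have := integrableD measurableT iu iv.
by apply: eq_integrable => // x _; rewrite /= EFinD.
Qed.

Lemma integrableZR (c : R) (u : Rd R d -> R) : mu.-integrable setT (EFin \o u) ->
  mu.-integrable setT (EFin \o (fun x => c * u x)).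
Proof.
move=> iu; have := integrableZl measurableT c iu.
by apply: eq_integrable => // x _; rewrite /= EFinM.
Qed.

Lemma cintegrableD g h : cintegrable g -> cintegrable h -> cintegrable (fun x => g x + h x).
Proof.
move=> [g1 g2] [h1 h2]; split.
  have := integrableDR g1 h1; apply: eq_integrable => // x _ /=.
  by case: (g x); case: (h x).
have := integrableDR g2 h2; apply: eq_integrable => // x _ /=.
by case: (g x); case: (h x).
Qed.

Lemma cintegralD g h : cintegrable g -> cintegrable h ->
  cintegral mu (fun x => g x + h x) = cintegral mu g + cintegral mu h.
Proof.
move=> [g1 g2] [h1 h2]; rewrite /cintegral.
have -> : (fun x => complex.Re (g x + h x)) = (fun x => complex.Re (g x) + complex.Re (h x)).
  by apply/funext => x; case: (g x); case: (h x).
have -> : (fun x => complex.Im (g x + h x)) = (fun x => complex.Im (g x) + complex.Im (h x)).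
  by apply/funext => x; case: (g x); case: (h x).
by rewrite !RintegralD.
Qed.

Lemma ReM (z w : R[i]) : complex.Re (z * w) =
  complex.Re z * complex.Re w - complex.Im z * complex.Im w.
Proof. by case: z; case: w. Qed.

Lemma ImM (z w : R[i]) : complex.Im (z * w) =
  complex.Re z * complex.Im w + complex.Im z * complex.Re w.
Proof. by case: z; case: w. Qed.

Lemma cintegrableZ c g : cintegrable g -> cintegrable (fun x => c * g x).
Proof.
move=> [g1 g2]; split.
  have := integrableDR (integrableZR (complex.Re c) g1) (integrableZR (- complex.Im c) g2).
  by apply: eq_integrable => // x _; rewrite /= ReM mulNr.
have := integrableDR (integrableZR (complex.Re c) g2) (integrableZR (complex.Im c) g1).
by apply: eq_integrable => // x _; rewrite /= ImM.
Qed.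

Lemma cintegralZ c g : cintegrable g ->
  cintegral mu (fun x => c * g x) = c * cintegral mu g.
Proof.
move=> [g1 g2]; rewrite /cintegral; apply/eqP; rewrite eq_complex ReM ImM /=.
have -> : (fun x => complex.Re (c * g x)) =
    (fun x => complex.Re c * complex.Re (g x) + (- complex.Im c) * complex.Im (g x)).
  by apply/funext => x; rewrite ReM mulNr.
have -> : (fun x => complex.Im (c * g x)) =
    (fun x => complex.Re c * complex.Im (g x) + complex.Im c * complex.Re (g x)).
  by apply/funext => x; rewrite ImM.
by rewrite !RintegralD ?RintegralZl ?mulNr ?eqxx //; exact: integrableZR.
Qed.

Lemma cintegrable0 : cintegrable (fun=> 0).
Proof. by split; exact: finite_measure_integrable_cst. Qed.

Lemma cintegral0 : cintegral mu (fun=> 0) = 0.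
Proof. by rewrite /cintegral /= Rintegral_cst // mul0r. Qed.

Lemma cintegrable_sum (I : Type) (s : seq I) (F : I -> Rd R d -> R[i]) :
  (forall i, cintegrable (F i)) -> cintegrable (fun x => \sum_(i <- s) F i x).
Proof.
move=> HF; elim: s => [|i s IHs].
  by under eq_fun do rewrite big_nil; exact: cintegrable0.
by under eq_fun do rewrite big_cons; exact: cintegrableD.
Qed.

Lemma cintegral_sum (I : Type) (s : seq I) (F : I -> Rd R d -> R[i]) :
  (forall i, cintegrable (F i)) ->
  cintegral mu (fun x => \sum_(i <- s) F i x) = \sum_(i <- s) cintegral mu (F i).
Proof.
move=> HF; elim: s => [|i s IHs].
  by under eq_fun do rewrite big_nil; rewrite big_nil cintegral0.
under eq_fun do rewrite big_cons.
by rewrite big_cons cintegralD // ?IHs //; exact: cintegrable_sum.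
Qed.

Definition bounded_measurable g : Prop :=
  measurable_fun setT (fun x => complex.Re (g x)) /\
  measurable_fun setT (fun x => complex.Im (g x)) /\
  (exists M, forall x, nsq (g x) <= M).

(** Both parts of [g h] are bounded by [|g| ^ 2 + |h| ^ 2 <= |g| ^ 2 + M]. *)
Lemma L2_cintegrableM g h : L2 mu g -> bounded_measurable h ->
  cintegrable (fun x => g x * h x).
Proof.
move=> [g1 [g2 ig]] [h1 [h2 [M HM]]].
have iG : mu.-integrable setT (EFin \o (fun x => M + nsq (g x))).
  by apply: integrableDR; [exact: finite_measure_integrable_cst | exact: ig].
have dom (u : Rd R d -> R) : measurable_fun setT u ->
    (forall x, `|u x| <= M + nsq (g x)) -> mu.-integrable setT (EFin \o u).
  move=> mu_ Hu; apply: le_integrable iG => //; first exact/measurable_EFinP.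
  by move=> x _; rewrite /= lee_fin (le_trans (Hu x)) // ler_norm.
split; apply: dom.
- have -> : (fun x => complex.Re (g x * h x)) = (fun x => complex.Re (g x) * complex.Re (h x) -
      complex.Im (g x) * complex.Im (h x)) by apply/funext => x; rewrite ReM.
  by apply: measurable_funB; exact: measurable_funM.
- move=> x; rewrite ReM; have := HM x; rewrite /nsq.
  move: (complex.Re (g x)) (complex.Im (g x)) (complex.Re (h x)) (complex.Im (h x)) => a b c e.
  move=> H; rewrite ler_norml; apply/andP; split.
    by have := sqr_ge0 (a + c); have := sqr_ge0 (b - e); nra.
  by have := sqr_ge0 (a - c); have := sqr_ge0 (b + e); nra.
- have -> : (fun x => complex.Im (g x * h x)) = (fun x => complex.Re (g x) * complex.Im (h x) +
      complex.Im (g x) * complex.Re (h x)) by apply/funext => x; rewrite ImM.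
  by apply: measurable_funD; exact: measurable_funM.
- move=> x; rewrite ImM; have := HM x; rewrite /nsq.
  move: (complex.Re (g x)) (complex.Im (g x)) (complex.Re (h x)) (complex.Im (h x)) => a b c e.
  move=> H; rewrite ler_norml; apply/andP; split.
    by have := sqr_ge0 (a + e); have := sqr_ge0 (b + c); nra.
  by have := sqr_ge0 (a - e); have := sqr_ge0 (b - c); nra.
Qed.

End ComplexIntegral.

(** * Weak convergence for complex test functions *)

Section WeakLimit.
Variables (R : realType) (d : nat) (mu : probability (Rd R d) R).

Lemma cvg_sum_seq (I : eqType) (s : seq I) (u : I -> nat -> R) (a : I -> R) :
  (forall i, u i k @[k --> \oo] --> a i) ->
  (\sum_(i <- s) u i k) @[k --> \oo] --> \sum_(i <- s) a i.
Proof.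
move=> H; elim: s => [|i s IHs].
  by under eq_fun do rewrite big_nil; rewrite big_nil; exact: cvg_cst.
by under eq_fun do rewrite big_cons; rewrite big_cons; exact: cvgD.
Qed.

Lemma cvg_nsq (z : nat -> R[i]) (c : R[i]) :
  complex.Re (z k) @[k --> \oo] --> complex.Re c ->
  complex.Im (z k) @[k --> \oo] --> complex.Im c ->
  nsq (z k) @[k --> \oo] --> nsq c.
Proof. by move=> h1 h2; rewrite /nsq; apply: cvgD; apply: cvgM. Qed.

Lemma coord_norm_le (x : 'rV[R]_d) i : `|x 0 i| <= `|x|.
Proof.
rewrite [leRHS]/Num.norm /= mx_normrE; apply/bigmax_geP; right.
by exists (0, i).
Qed.

Lemma dotv_continuous (lam : 'rV[R]_d) : continuous (dotv lam).
Proof.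
apply: lipschitz_continuous; exists (\sum_i `|lam 0 i|) => x y.
rewrite /dotv -sumrB mulr_suml; apply: le_trans (ler_norm_sum _ _ _) _.
apply: ler_sum => i _; rewrite -mulrBr normrM ler_wpM2l //.
by have := coord_norm_le (x - y) i; rewrite !mxE.
Qed.

Definition bounded_continuous (F : 'rV[R]_d -> R[i]) : Prop :=
  [/\ continuous (fun x => complex.Re (F x)), continuous (fun x => complex.Im (F x))
    & exists M, forall x, nsq (F x) <= M].

Lemma bc_e1 lam : bounded_continuous (fun x => e1 (dotv lam x)).
Proof.
have c2 : continuous (fun x : 'rV[R]_d => 2 * pi * dotv lam x).
  move=> x; apply: (@continuousM _ _ (fun=> 2 * pi) (dotv lam)).
    exact: cst_continuous.
  exact: dotv_continuous.
split.
- move=> x; exact: (@continuous_comp _ _ _ (fun x => 2 * pi * dotv lam x)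
    (@cos R) x (c2 x) (@continuous_cos R _)).
- move=> x; exact: (@continuous_comp _ _ _ (fun x => 2 * pi * dotv lam x)
    (@sin R) x (c2 x) (@continuous_sin R _)).
- by exists 1 => x; rewrite nsq_e1.
Qed.

Lemma bc_mul F G : bounded_continuous F -> bounded_continuous G ->
  bounded_continuous (fun x => F x * G x).
Proof.
move=> [f1 f2 [M HM]] [g1 g2 [N HN]]; split.
- under eq_fun do rewrite ReM.
  move=> x; apply: (@continuousB _ _ _ (fun x => complex.Re (F x) * complex.Re (G x))
    (fun x => complex.Im (F x) * complex.Im (G x))).
    exact: continuousM (f1 x) (g1 x).
  exact: continuousM (f2 x) (g2 x).
- under eq_fun do rewrite ImM.
  move=> x; apply: (@continuousD _ _ _ (fun x => complex.Re (F x) * complex.Im (G x))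
    (fun x => complex.Im (F x) * complex.Re (G x))).
    exact: continuousM (f1 x) (g2 x).
  exact: continuousM (f2 x) (g1 x).
- by exists (M * N) => x; rewrite nsqM ler_pM ?nsq_ge0.
Qed.

Lemma bc_bounded_measurable F : bounded_continuous F ->
  bounded_measurable (F : Rd R d -> R[i]).
Proof.
by move=> [/continuous_measurable_Rd f1 /continuous_measurable_Rd f2 fM]; split.
Qed.

Lemma nsq_measurable (F : Rd R d -> R[i]) :
  measurable_fun setT (fun x => complex.Re (F x)) ->
  measurable_fun setT (fun x => complex.Im (F x)) ->
  measurable_fun setT (fun x => nsq (F x)).
Proof. by move=> f1 f2; apply: measurable_funD; exact: measurable_funX. Qed.

Lemma bounded_measurable_L2 F : bounded_measurable F -> L2 mu F.
Proof.
move=> [f1 [f2 [M HM]]]; split=> //; split=> //.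
have iM : mu.-integrable setT (EFin \o (fun=> M : R) : Rd R d -> \bar R).
  exact: finite_measure_integrable_cst.
apply: le_integrable iM => //.
  by apply/measurable_EFinP; exact: (nsq_measurable f1 f2).
move=> x _; rewrite /= lee_fin ger0_norm ?(nsq_ge0 (F x)) //.
exact: le_trans (HM x) (ler_norm _).
Qed.

Variables (m : nat -> 'I_d -> nat) (Bs : nat -> seq 'rV[int]_d).
Hypothesis Hmu : weak_limit m Bs mu.

(** Stated along any sequence of levels tending to infinity: it serves for [ns k] and, at fixed [j],
    for [ns j + k]. *)
Lemma weak_limit_real (f : 'rV[R]_d -> R) (M : R) (u : nat -> nat) :
  continuous f -> (forall x, f x ^+ 2 <= M) -> u k @[k --> \oo] --> \oo ->
  conv_integral m Bs (u k) f @[k --> \oo] --> Rintegral mu setT (f : Rd R d -> R).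
Proof.
move=> cf HM uoo.
have : exists M, forall x, `|f x| <= M.
  exists (M + 1) => x; have := HM x; rewrite -real_normK ?num_real //.
  by have := normr_ge0 (f x); move: `|f x| => a; nra.
by move=> /(Hmu cf) H; exact: (cvg_comp _ _ uoo H).
Qed.

Lemma weak_limit_Re F (u : nat -> nat) : bounded_continuous F ->
  u k @[k --> \oo] --> \oo ->
  complex.Re (cavg m Bs (u k) F) @[k --> \oo] --> complex.Re (cintegral mu F).
Proof.
move=> [f1 f2 [M HM]] uoo; under eq_fun do rewrite Re_cavg.
apply: (@weak_limit_real _ M) => // x.
exact: le_trans (Re_sqr_le _) (HM x).
Qed.

Lemma weak_limit_Im F (u : nat -> nat) : bounded_continuous F ->
  u k @[k --> \oo] --> \oo ->
  complex.Im (cavg m Bs (u k) F) @[k --> \oo] --> complex.Im (cintegral mu F).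
Proof.
move=> [f1 f2 [M HM]] uoo; under eq_fun do rewrite Im_cavg.
apply: (@weak_limit_real _ M) => // x.
exact: le_trans (Im_sqr_le _) (HM x).
Qed.

Lemma cintegral_limit_const F (u : nat -> nat) (c : R[i]) : bounded_continuous F ->
  u k @[k --> \oo] --> \oo -> (\forall k \near \oo, cavg m Bs (u k) F = c) ->
  cintegral mu F = c.
Proof.
move=> bF uoo Hc; apply/eqP; rewrite eq_complex; apply/andP; split; apply/eqP.
  rewrite -(cvg_lim (@Rhausdorff R) (weak_limit_Re bF uoo)).
  apply: (cvg_lim (@Rhausdorff R)); apply: cvg_near_cst.
  by apply: filterS Hc => k ->.
rewrite -(cvg_lim (@Rhausdorff R) (weak_limit_Im bF uoo)).
apply: (cvg_lim (@Rhausdorff R)); apply: cvg_near_cst.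
by apply: filterS Hc => k ->.
Qed.

End WeakLimit.

(** * Bessel's inequality *)

Section Bessel.
Variables (R : realType) (d : nat) (mu : probability (Rd R d) R).

Lemma bm_expo (lam : 'rV[R]_d) : bounded_measurable (expo lam).
Proof. exact: (bc_bounded_measurable (bc_e1 lam)). Qed.

Lemma conj_bm (g : Rd R d -> R[i]) : bounded_measurable g ->
  bounded_measurable (fun x => conjc (g x)).
Proof.
move=> [g1 [g2 [M HM]]]; split; [|split].
- rewrite (_ : (fun x => _) = fun x => complex.Re (g x)) //.
  by apply/funext => x; case: (g x).
- rewrite (_ : (fun x => _) = fun x => - complex.Im (g x)); first exact: measurableT_comp.
  by apply/funext => x; case: (g x).
- by exists M => x; have := HM x; rewrite /nsq; case: (g x) => a b /=; rewrite sqrrN.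
Qed.

Lemma bm_sum (I : Type) (s : seq I) (c : I -> R[i]) (F : I -> Rd R d -> R[i]) :
  (forall i, bounded_measurable (F i)) ->
  bounded_measurable (fun x => \sum_(i <- s) c i * F i x).
Proof.
move=> HF; split; [|split].
- under eq_fun do rewrite Re_sum.
  apply: measurable_sum => i; under eq_fun do rewrite ReM.
  by have [h1 [h2 _]] := HF i; apply: measurable_funB; apply: measurable_funM.
- under eq_fun do rewrite Im_sum.
  apply: measurable_sum => i; under eq_fun do rewrite ImM.
  by have [h1 [h2 _]] := HF i; apply: measurable_funD; apply: measurable_funM.
- have [M HM] : exists M : I -> R, forall i x, nsq (F i x) <= M i.
    have H i : exists M : R, forall x, nsq (F i x) <= M by case: (HF i) => _ [].
    by have [M HM] := choice H; exists M.
  exists ((size s)%:R * \sum_(i <- s) nsq (c i) * M i) => x.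
  apply: le_trans (nsq_sum_le _ _) _; rewrite ler_wpM2l //.
  by apply: ler_sum => i _; rewrite nsqM ler_wpM2l ?nsq_ge0.
Qed.

Lemma L2_nsq_integrable (v : Rd R d -> R[i]) : L2 mu v ->
  mu.-integrable setT (EFin \o (fun x => nsq (v x))).
Proof. by move=> [_ [_]]. Qed.

(** Expand the integral of [|v - p| ^ 2 >= 0] for the orthogonal projection [p]; both [<v, p>] and
    [<p, p>] equal the sum [s] of the squared coefficients. *)
Lemma bessel (I : eqType) (S : seq I) (e : I -> Rd R d -> R[i]) (v : Rd R d -> R[i]) :
  uniq S -> (forall i, bounded_measurable (e i)) -> L2 mu v ->
  (forall i j, i \in S -> j \in S -> inner mu (e i) (e j) = (i == j)%:R) ->
  \sum_(i <- S) nsq (inner mu v (e i)) <= Rintegral mu setT (fun x => nsq (v x)).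
Proof.
move=> uS be Lv orth.
pose c i := inner mu v (e i).
pose p x := \sum_(i <- S) c i * e i x.
set s := \sum_(i <- S) _.
have bp : bounded_measurable p by exact: bm_sum.
have conjp x : conjc (p x) = \sum_(i <- S) conjc (c i) * conjc (e i x).
  by rewrite /p rmorph_sum; apply: eq_bigr => i _; rewrite rmorphM.
have ivp : cintegrable mu (fun x => v x * conjc (p x)).
  by apply: L2_cintegrableM => //; exact: conj_bm.
have ipp : cintegrable mu (fun x => p x * conjc (p x)).
  by apply: L2_cintegrableM; [exact: bounded_measurable_L2 | exact: conj_bm].
have iep (w : Rd R d -> R[i]) : L2 mu w -> cintegral mu (fun x => w x * conjc (p x)) =
    \sum_(i <- S) conjc (c i) * inner mu w (e i).
  move=> Lw.
  have iw i : cintegrable mu (fun x => w x * conjc (e i x)).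
    by apply: L2_cintegrableM => //; exact: conj_bm.
  rewrite (_ : (fun x => _) = fun x => \sum_(i <- S) conjc (c i) * (w x * conjc (e i x))).
    rewrite cintegral_sum; last by move=> i; exact: cintegrableZ.
    by apply: eq_bigr => i _; rewrite cintegralZ.
  by apply/funext => x; rewrite conjp mulr_sumr; apply: eq_bigr => i _; rewrite mulrCA.
have J1 : cintegral mu (fun x => v x * conjc (p x)) = (s%:C)%C.
  rewrite iep // /s rmorph_sum; apply: eq_bigr => i _.
  by rewrite mulrC mulr_conjc.
have J2 : cintegral mu (fun x => p x * conjc (p x)) = (s%:C)%C.
  have iei i : cintegrable mu (fun x => e i x * conjc (p x)).
    by apply: L2_cintegrableM; [exact: bounded_measurable_L2 | exact: conj_bm].
  rewrite (_ : (fun x => _) = fun x => \sum_(i <- S) c i * (e i x * conjc (p x))); last first.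
    by apply/funext => x; rewrite [X in X * _]/p mulr_suml; apply: eq_bigr => i _; rewrite mulrA.
  rewrite cintegral_sum; last by move=> i; exact: cintegrableZ.
  rewrite /s rmorph_sum big_seq [RHS]big_seq; apply: eq_bigr => i iS.
  rewrite cintegralZ // iep; last exact: bounded_measurable_L2.
  transitivity (c i * conjc (c i)); last exact: mulr_conjc.
  congr (_ * _); rewrite (bigD1_seq i) //= orth // eqxx mulr1 big_seq_cond big1 ?addr0 // => j /andP[jS ji].
  by rewrite orth // eq_sym (negbTE ji) mulr0.
have iv := L2_nsq_integrable Lv.
have := Rintegral_ge0 mu (D := setT) (fun x _ => nsq_ge0 (v x - p x)).
have -> : (fun x => nsq (v x - p x)) = (fun x => nsq (v x) +
    ((-2) * complex.Re (v x * conjc (p x)) + complex.Re (p x * conjc (p x)))).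
  apply/funext => x; case: (v x) => a b; case: (p x) => a' b'; rewrite /nsq /=; ring.
have i1 := integrableZR (-2) ivp.1.
rewrite RintegralD //; last exact: integrableDR i1 ipp.1.
rewrite (RintegralD measurableT i1 ipp.1) (RintegralZl _ measurableT ivp.1).
have -> : \int[mu]_x complex.Re (v x * conjc (p x)) = s by rewrite -[RHS]/(complex.Re (s%:C)%C) -J1.
have -> : \int[mu]_x complex.Re (p x * conjc (p x)) = s by rewrite -[RHS]/(complex.Re (s%:C)%C) -J2.
lra.
Qed.

End Bessel.

(** * Orthonormality and completeness of the union of the sets [S j] *)

Section Spectrum.
Variables (R : realType) (d : nat).
Variables (m : nat -> 'I_d -> nat) (Bs : nat -> seq 'rV[int]_d).
Hypothesis HD : forall n, in_Dd (m n) (Bs n).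
Variable mu : probability (Rd R d) R.
Hypothesis Hmu : weak_limit m Bs mu.
Variables (eps : R) (ns : nat -> nat) (S : nat -> seq 'rV[int]_d).
Hypothesis eps0 : 0 < eps.
Hypothesis HS : forall j, [/\ (j <= ns j)%N, parseval R m Bs (ns j) (S j),
  {subset S j <= S j.+1} & forall l, l \in S j -> forall k, eps <= tln R m Bs (ns j) k l].

Let ns_cvg : ns k @[k --> \oo] --> \oo.
Proof.
apply/cvgnyPge => A; near=> k; have [kn _ _ _] := HS k.
by apply: leq_trans kn; near: k; exact: nbhs_infty_ge.
Unshelve. all: by end_near. Qed.

Lemma S_mono i j : (i <= j)%N -> {subset S i <= S j}.
Proof.
move=> /subnKC <-; elim: (j - i)%N => [|k IHk] l; first by rewrite addn0.
by rewrite addnS => /IHk; have [_ _ + _] := HS (i + k)%N; apply.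
Qed.

(** For large [k] both frequencies lie in [S k], and by Parseval the average over the atoms of level
    [ns k] is exactly 0 or 1; so the sequence converging to the integral is eventually constant. *)
Lemma spectrum_orthonormal i j l l' : l \in S i -> l' \in S j ->
  inner mu (expo (toR R l)) (expo (toR R l')) = (l == l')%:R.
Proof.
move=> lS l'S.
have FE x : expo (toR R l) x * conjc (expo (toR R l') x) = e1 (dotv (toR R l - toR R l') x).
  by rewrite -[expo (toR R l') x]/(e1 _) -e1N -[expo _ _]/(e1 _) -e1D dotvBl.
rewrite /inner; under eq_fun do rewrite FE.
apply: (cintegral_limit_const Hmu (bc_e1 _) ns_cvg); near=> k.
have lk : l \in S k.
  by apply: S_mono lS; near: k; exact: nbhs_infty_ge.
have l'k : l' \in S k.
  by apply: S_mono l'S; near: k; exact: nbhs_infty_ge.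
have [_ Hk _ _] := HS k; rewrite /cavg.
have [<-|ll'] := eqVneq l l'; last first.
  by rewrite (parseval_orth Hk l'k lk) ?mulr0 // eq_sym.
rewrite subrr (eq_bigr (fun=> 1)) => [|x _]; last by rewrite dotv0l e1_0.
rewrite sum_const_seq /= -(rmorph_nat (real_complex R)) -rmorphM /= mulVf //.
by rewrite pnatr_eq0 -lt0n size_X_gt0.
Unshelve. all: by end_near. Qed.

Lemma Rintegral_dist2_le (f : Rd R d -> R[i]) (g1 g2 : Rd R d -> R) (eta : R) :
  measurable_fun setT (fun x => complex.Re (f x)) ->
  measurable_fun setT (fun x => complex.Im (f x)) ->
  measurable_fun setT g1 -> measurable_fun setT g2 ->
  (dist2 mu (fun x => complex.Re (f x)) g1 < eta%:E)%E ->
  (dist2 mu (fun x => complex.Im (f x)) g2 < eta%:E)%E ->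
  Rintegral mu setT (fun x => nsq ((g1 x +i* g2 x)%C - f x)) <= 2 * eta.
Proof.
move=> f1 f2 mg1 mg2 h1 h2; rewrite /Rintegral.
have -> : (\int[mu]_x (nsq ((g1 x +i* g2 x)%C - f x))%:E =
    dist2 mu (fun x => complex.Re (f x)) g1 + dist2 mu (fun x => complex.Im (f x)) g2)%E.
  rewrite /dist2 -ge0_integralD //.
  - apply: eq_integral => x _; rewrite -EFinD; congr EFin.
    by rewrite /nsq; case: (f x) => a b /=; ring.
  - by move=> x _; rewrite lee_fin sqr_ge0.
  - exact: measurable_dist2.
  - by move=> x _; rewrite lee_fin sqr_ge0.
  - exact: measurable_dist2.
have d0 u v : (0 <= dist2 mu u v)%E.
  by apply: integral_ge0 => x _; rewrite lee_fin sqr_ge0.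
have n1 : dist2 mu (fun x => complex.Re (f x)) g1 \is a fin_num.
  by rewrite ge0_fin_numE // (lt_trans h1) // ltry.
have n2 : dist2 mu (fun x => complex.Im (f x)) g2 \is a fin_num.
  by rewrite ge0_fin_numE // (lt_trans h2) // ltry.
rewrite fineD // mulr_natl mulr2n; apply: lerD.
  by rewrite -lee_fin fineK // ltW.
by rewrite -lee_fin fineK // ltW.
Qed.

Lemma BL_bounded_continuous (g1 g2 : 'rV[R]_d -> R) :
  bounded_lipschitz g1 -> bounded_lipschitz g2 ->
  bounded_continuous (fun x => (g1 x +i* g2 x)%C).
Proof.
move=> [/lipschitz_continuous c1 [M HM]] [/lipschitz_continuous c2 [N HN]]; split => //.
exists (M ^+ 2 + N ^+ 2) => x; rewrite /nsq /=; apply: lerD.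
  by rewrite -real_normK ?num_real //; apply: lerXn2r; rewrite ?nnegrE // (le_trans _ (HM x)).
by rewrite -real_normK ?num_real //; apply: lerXn2r; rewrite ?nnegrE // (le_trans _ (HN x)).
Qed.

Lemma oscillation_tail (g1 g2 : 'rV[R]_d -> R) :
  bounded_lipschitz g1 -> bounded_lipschitz g2 ->
  exists2 C : R, 0 <= C & forall j k x y, y \in tail_points R m Bs (ns j) k ->
    nsq ((g1 (x + y) +i* g2 (x + y))%C - (g1 x +i* g2 x)%C) <= C * j.+1%:R^-1.
Proof.
move=> [[K HK] _] [[L HL] _]; exists (K ^+ 2 + L ^+ 2); first by rewrite addr_ge0 ?sqr_ge0.
move=> j k x y /(tail_norm_le HD) yn.
have [jn _ _ _] := HS j.
have y1 : `|y| <= j.+1%:R^-1.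
  by rewrite (le_trans yn) // lef_pV2 ?posrE ?ltr0n // ler_nat.
(* One factor [|y| <= 1] is discarded: the rate [1 / (j + 1)] already tends to 0. *)
have y2 : `|y| ^+ 2 <= j.+1%:R^-1.
  rewrite (le_trans _ y1) // expr2 ler_piMr // (le_trans y1) // invf_le1 ?ltr0n //.
  by rewrite ler1n.
have sq (h : 'rV[R]_d -> R) (M : R) : (forall x y, `|h x - h y| <= M * `|x - y|) ->
    (h (x + y) - h x) ^+ 2 <= M ^+ 2 * `|y| ^+ 2.
  move=> Hh; have Hxy : `|h (x + y) - h x| <= M * `|y|.
    by have := Hh (x + y) x; rewrite [x + y - x]addrAC subrr add0r.
  rewrite -real_normK ?num_real // -exprMn; apply: lerXn2r; rewrite ?nnegrE //.
  exact: le_trans Hxy.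
rewrite /nsq /= mulrDl; apply: lerD.
  by apply: le_trans (sq _ _ HK) _; rewrite ler_wpM2l ?sqr_ge0.
by apply: le_trans (sq _ _ HL) _; rewrite ler_wpM2l ?sqr_ge0.
Qed.

(** For a bounded Lipschitz [g] close to [f] and [v = g - f], orthogonality gives [g] the same
    coefficients as [v]. These are small by Bessel, so the frame inequality makes [g] small, and
    then [f]. *)
Lemma spectrum_complete (f : Rd R d -> R[i]) : L2 mu f ->
  (forall j l, l \in S j -> inner mu f (expo (toR R l)) = 0) ->
  {ae mu, forall x, f x = 0}.
Proof.
move=> Lf orth; have [f1 [f2 if12]] := Lf.
have if_ : mu.-integrable setT (EFin \o (fun x => nsq (f x))) by exact: if12.
have sqi (u : Rd R d -> R) : measurable_fun setT u ->
    (forall x, u x ^+ 2 <= nsq (f x)) -> mu.-integrable setT (EFin \o (fun x => u x ^+ 2)).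
  move=> mu_ Hu; apply: le_integrable if_ => //.
    by apply/measurable_EFinP; exact: measurable_funX.
  by move=> x _; rewrite /= lee_fin !ger0_norm ?sqr_ge0 ?nsq_ge0.
have [_ A1] := approximable_L2 f1 (sqi _ f1 (fun x => Re_sqr_le (f x))).
have [_ A2] := approximable_L2 f2 (sqi _ f2 (fun x => Im_sqr_le (f x))).
pose E := Rintegral mu setT (fun x => nsq (f x)).
have E0 : 0 <= E by apply: Rintegral_ge0 => x _; exact: nsq_ge0.
(* The constant collects [||f||^2 <= 2 ||g||^2 + 2 ||v||^2] with [||g||^2 <= 4 eta / eps] and
   [||v||^2 <= 2 eta]. *)
suff key (eta : R) : 0 < eta -> E <= (8 / eps + 4) * eta.
  have E_le0 : E <= 0.
    have C0 : 0 < 8 / eps + 4 by rewrite addr_gt0 // divr_gt0.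
    apply/ler_addgt0Pr => e e0; rewrite add0r.
    have := key (e / (8 / eps + 4)) (divr_gt0 e0 C0).
    by rewrite mulrCA mulfV ?gt_eqF // mulr1.
  have EE : E = 0 by apply/eqP; rewrite eq_le E_le0.
  have : (\int[mu]_x `|(nsq (f x))%:E| = 0)%E.
    under eq_integral do rewrite gee0_abs ?lee_fin ?nsq_ge0 //.
    rewrite -[LHS]fineK; last exact: (integrable_fin_num measurableT if_).
    by rewrite -/(Rintegral mu setT (fun x => nsq (f x))) -/E EE.
  move=> /(ae_eq_integral_abs mu measurableT) H.
  have {}H := H (measurable_int mu if_).
  by apply: filterS H => x /(_ I) /= [] /nsq_eq0.
move=> eta0.
have [g1 B1 D1] := A1 _ eta0; have [g2 B2 D2] := A2 _ eta0.
pose g (x : 'rV[R]_d) : R[i] := (g1 x +i* g2 x)%C.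
have bg : bounded_continuous g by exact: BL_bounded_continuous.
have [_ _ [M HM]] := bg.
have Lg : L2 mu g by exact/bounded_measurable_L2/bc_bounded_measurable.
pose v (x : Rd R d) : R[i] := g x + (-1) * f x.
have vE x : v x = g x - f x by rewrite /v mulN1r.
have v2 : Rintegral mu setT (fun x => nsq (v x)) <= 2 * eta.
  under eq_fun do rewrite vE.
  by apply: Rintegral_dist2_le => //; exact: BL_measurable.
have [mg1 [mg2 _]] := Lg.
have mv1 : measurable_fun setT (fun x => complex.Re (v x)).
  rewrite (_ : (fun x => _) = fun x => complex.Re (g x) - complex.Re (f x)).
    exact: measurable_funB.
  by apply/funext => x; rewrite vE raddfB.
have mv2 : measurable_fun setT (fun x => complex.Im (v x)).
  rewrite (_ : (fun x => _) = fun x => complex.Im (g x) - complex.Im (f x)).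
    exact: measurable_funB.
  by apply/funext => x; rewrite vE raddfB.
have iv : mu.-integrable setT (EFin \o (fun x => nsq (v x))).
  have iM : mu.-integrable setT (EFin \o (fun x : Rd R d => 2 * M + 2 * nsq (f x))).
    apply: integrableDR; first exact: finite_measure_integrable_cst.
    exact: integrableZR.
  apply: le_integrable iM => //.
    by apply/measurable_EFinP; exact: nsq_measurable mv1 mv2.
  move=> x _; rewrite /= lee_fin ger0_norm ?nsq_ge0 // (le_trans _ (ler_norm _)) //.
  rewrite vE; have := HM x; rewrite /nsq; case: (f x) => a b; rewrite /g /=.
  move: (g1 x) (g2 x) => a' b'; have := sqr_ge0 (a' + a); have := sqr_ge0 (b' + b); nra.
have Lv : L2 mu v by [].
have bce l : bounded_measurable (fun x => conjc (expo (toR R l) x)).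
  exact/conj_bm/bm_expo.
have inner_v j l : l \in S j -> inner mu v (expo (toR R l)) = inner mu g (expo (toR R l)).
  move=> lS; rewrite /inner /v.
  have ig : cintegrable mu (fun x => g x * conjc (expo (toR R l) x)) by exact: L2_cintegrableM.
  have if' : cintegrable mu (fun x => f x * conjc (expo (toR R l) x)) by exact: L2_cintegrableM.
  rewrite (_ : (fun x => _) = fun x => g x * conjc (expo (toR R l) x) +
     (-1) * (f x * conjc (expo (toR R l) x))); last by apply/funext => x; rewrite mulrDl mulrA.
  rewrite cintegralD //; last exact: cintegrableZ.
  by rewrite cintegralZ // -/(inner mu f _) (orth j) // mulr0 addr0.
have coef j : \sum_(l <- S j) nsq (inner mu g (expo (toR R l))) <= 2 * eta.
  apply: le_trans v2.
  rewrite big_seq (eq_bigr (fun l => nsq (inner mu v (expo (toR R l))))); last first.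
    by move=> l lS; rewrite (inner_v j).
  rewrite -big_seq; apply: bessel => //.
  - by have [_ /(parseval_uniq HD) + _ _] := HS j.
  - by move=> l; exact: bm_expo.
  - by move=> l l' lS l'S; exact: spectrum_orthonormal lS l'S.
have [C C0 osc] := oscillation_tail B1 B2.
(* At fixed [j], [k] tends to infinity first and turns the coefficients at level [ns j + k] into
   those for [mu]; [j] follows in [gle] and removes the oscillation term. *)
have step j : eps * conv_integral m Bs (ns j) (fun x => nsq (g x)) <=
    4 * eta + 2 * (C * j.+1%:R^-1).
  have [jn Hpars _ Htl] := HS j.
  have w0 : 0 <= C * j.+1%:R^-1 by rewrite mulr_ge0 // invr_ge0.
  have fb k := @frame_bound R d m Bs HD (ns j) k (S j) eps _ g Hpars w0
    (fun l lS => Htl l lS k) (fun x y _ yT => osc j k x y yT).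
  have lim : (2 * \sum_(l <- S j) nsq (cavg m Bs (ns j + k)
        (fun x => g x * e1 (- dotv (toR R l) x))) + 2 * (C * j.+1%:R^-1)) @[k --> \oo] -->
      2 * \sum_(l <- S j) nsq (inner mu g (expo (toR R l))) + 2 * (C * j.+1%:R^-1).
    apply: cvgD; last exact: cvg_cst.
    apply: cvgM; first exact: cvg_cst.
    apply: cvg_sum_seq => l.
    have bF : bounded_continuous (fun x => g x * e1 (- dotv (toR R l) x)).
      apply: bc_mul => //; rewrite (_ : (fun x => _) = fun x => e1 (dotv (- toR R l) x)).
        exact: bc_e1.
      by apply/funext => x; rewrite -[- toR R l]add0r dotvBl dotv0l sub0r.
    have -> : inner mu g (expo (toR R l)) = cintegral mu (fun x => g x * e1 (- dotv (toR R l) x)).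
      by rewrite /inner; congr cintegral; apply/funext => x; rewrite e1N.
    apply: cvg_nsq.
      exact: (weak_limit_Re Hmu bF (cvg_addnl (ns j))).
    exact: (weak_limit_Im Hmu bF (cvg_addnl (ns j))).
  apply: (@le_trans _ _ (2 * \sum_(l <- S j) nsq (inner mu g (expo (toR R l))) +
                         2 * (C * j.+1%:R^-1))); last first.
    rewrite lerD2r (_ : 4 * eta = 2 * (2 * eta)); last by ring.
    by rewrite ler_pM2l.
  by apply: (ler_cvg_to _ lim); [exact: cvg_cst | exact: nearW].
have [gc1 gc2 _] := bg.
have cng : continuous (fun x => nsq (g x)).
  move=> x; apply: (@continuousD _ _ _ (fun x => complex.Re (g x) * complex.Re (g x))
    (fun x => complex.Im (g x) * complex.Im (g x))).
    exact: continuousM (gc1 x) (gc1 x).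
  exact: continuousM (gc2 x) (gc2 x).
have ig := L2_nsq_integrable Lg.
have gle : eps * Rintegral mu setT (fun x : Rd R d => nsq (g x)) <= 4 * eta.
  have c1 : eps * conv_integral m Bs (ns j) (fun x => nsq (g x)) @[j --> \oo] -->
      eps * Rintegral mu setT (fun x : Rd R d => nsq (g x)).
    apply: cvgM; first exact: cvg_cst.
    apply: (weak_limit_real Hmu (M := M ^+ 2) cng _ ns_cvg) => x.
    by apply: lerXn2r; rewrite ?nnegrE ?nsq_ge0 // (le_trans _ (HM x)) ?nsq_ge0.
  have c2 : (4 * eta + 2 * (C * j.+1%:R^-1)) @[j --> \oo] --> 4 * eta + 2 * (C * 0).
    apply: cvgD; first exact: cvg_cst.
    apply: cvgM; first exact: cvg_cst.
    apply: cvgM; [exact: cvg_cst | exact: cvg_harmonic].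
  rewrite (_ : 4 * eta = 4 * eta + 2 * (C * 0)); last by rewrite !mulr0 addr0.
  by apply: (ler_cvg_to c1 c2); exact: nearW.
apply: (@le_trans _ _ (2 * Rintegral mu setT (fun x : Rd R d => nsq (g x)) +
                       2 * Rintegral mu setT (fun x => nsq (v x)))).
  rewrite -!RintegralZl // -RintegralD //; last 2 first.
    exact: integrableZR.
    exact: integrableZR.
  apply: le_Rintegral => //.
    by apply: integrableDR; exact: integrableZR.
  by move=> x _; rewrite vE; exact: nsqB_le.
rewrite (_ : (8 / eps + 4) * eta = 2 * (4 * eta / eps) + 2 * (2 * eta)); last by ring.
apply: lerD; last by rewrite ler_pM2l.
by rewrite ler_pM2l // ler_pdivlMr // mulrC.
Qed.

End Spectrum.

(** * Assembly of the spectrum *)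

Theorem theorem1p6 (R : realType) (d : nat)
    (m : nat -> 'I_d -> nat) (Bs : nat -> seq 'rV[int]_d)
    (HD : forall n, in_Dd (m n) (Bs n))
    (Hadm : forall n, admissible R (m n) (Bs n))
    (Hrep : exists (m0 : 'I_d -> nat) (B0 : seq 'rV[int]_d),
        (forall i, (d.+1 <= m0 i)%N) /\
        (forall N : nat, exists n : nat, (N <= n)%N /\
           (forall i, m n i = m0 i) /\ Bs n =i B0))
    (mu : probability (Rd R d) R)
    (Hmu : weak_limit m Bs mu) :
  exists Lam : set 'rV[R]_d, Lam `<=` @Zd R d /\ is_spectrum mu Lam.
Proof.
have [eps eps0 [ns [S HS]]] := nested_spectra HD Hadm Hrep.
exists [set toR R l | l in [set l | exists j, l \in S j]]; split.
  by move=> _ [l _ <-] i; rewrite mxE intr_int.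
split; first exact: card_le_trans (card_image_le _ _) (countableP _).
split; first by move=> _ [l _ <-]; exact/bounded_measurable_L2/bm_expo.
split.
  move=> _ _ [l [i lS] <-] [l' [j l'S] <-].
  by rewrite (spectrum_orthonormal HD Hmu HS lS l'S) (inj_eq (@toR_inj R d)).
move=> f Lf orth; apply: (spectrum_complete HD Hmu eps0 HS) => // j l lS.
by apply: orth; exists l => //; exists j.
Qed.
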